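(* Let $(\mathfrak g,\nu,\alpha)$ be a finite-dimensional simple Hom-Lie algebra over a field of characteristic zero. Then $$\widetilde H^1(\mathfrak g,\mathfrak g)=\mathrm{Der}_\alpha(\mathfrak g),\qquad \widetilde H^2(\mathfrak g,\mathfrak g)\cong \alpha(\mathrm{Der}(\mathfrak g))\big/\partial_\alpha(\mathrm{Der}(\mathfrak g)),\qquad \widetilde H^k(\mathfrak g,\mathfrak g)=0\ \text{ for } k\ge3,$$ where $\widetilde H^\bullet(\mathfrak g,\mathfrak g)$ is the $\alpha$-type cohomology of $\mathfrak g$ with values in itself.
   Context: A Hom-Lie algebra $(\mathfrak g,\nu,\alpha)$ is a vector space with a linear map $\alpha$ and a skew-symmetric bilinear bracket $\nu(x\otimes y)=[x,y]$ with $[[x,y],\alpha(z)]+[[y,z],\alpha(x)]+[[z,x],\alpha(y)]=0$ and $\alpha([x,y])=[\alpha(x),\alpha(y)]$. It is simple if $\alpha\ne0$, $[\mathfrak g,\mathfrak g]=\mathfrak g\neq0$, and the only subspaces $I\subseteq\mathfrak g$ with $\alpha(I)\subseteq I$ and $[I,\mathfrak g]\subseteq I$ are $0$ and $\mathfrak g$. $\mathrm{Der}(\mathfrak g)$ is the space of derivations, i.e. linear maps $\varphi:\mathfrak g\to\mathfrak g$ with $\varphi([x,y])=[\varphi(x),y]+[x,\varphi(y)]$; $\mathrm{Der}_\alpha(\mathfrak g)=\{\varphi\in\mathrm{Der}(\mathfrak g):\alpha\varphi=\varphi\alpha\}$; $\alpha(\mathrm{Der}(\mathfrak g))=\{\alpha\circ\varphi:\varphi\in\mathrm{Der}(\mathfrak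 g)\}$; and $\partial_\alpha\varphi=\alpha\varphi-\varphi\alpha$ for $\varphi\in\mathrm{Hom}(\mathfrak g,\mathfrak g)$. The $\alpha$-type cohomology $\widetilde H^\bullet(\mathfrak g,\mathfrak g)$ is the cohomology of the complex $\widetilde C^n(\mathfrak g)=\mathrm{Hom}(\Lambda^n\mathfrak g,\mathfrak g)\oplus\mathrm{Hom}(\Lambda^{n-1}\mathfrak g,\mathfrak g)\ni(\varphi,\psi)$, where $\mathrm{Hom}(\Lambda^k\mathfrak g,\mathfrak g)$ is set to $0$ for $k\le0$ (including $k=0$), with differential $\partial(\varphi,\psi)=(\partial_{\nu\nu}\varphi-\partial_{\alpha\nu}\psi,\ \partial_{\nu\alpha}\varphi-\partial_{\alpha\alpha}\psi)$, where (hats denote omission) $$(\partial_{\nu\nu}\varphi)(x_1,\dots,x_{n+1})=\sum_{i}(-1)^{i+1}[\alpha^{n-1}(x_i),\varphi(\dots,\widehat{x_i},\dots)]-\sum_{i<j}(-1)^{i+j-1}\varphi([x_i,x_j],\alpha(x_1),\dots,\widehat{x_i},\dots,\widehat{x_j},\dots,\alpha(x_{n+1})),$$ $$(\partial_{\alpha\alpha}\psi)(x_1,\dots,x_n)=\sum_{i}(-1)^{i+1}[\alpha^{n-1}(x_i),\psi(\dots,\widehat{x_i},\dots)]-\sum_{i<j}(-1)^{i+j-1}\psi([x_i,x_j],\alpha(x_1),\dots,\widehat{x_i},\dots,\widehat{x_j},\dots,\alpha(x_n)),$$ $$(\partial_{\nu\alpha}\varphi)(x_1,\dots,x_n)=\alpha(\varphi(x_1,\dots,x_n))-\varphi(\alpha(x_1),\dots,\alpha(x_n)),$$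 $$(\partial_{\alpha\nu}\psi)(x_1,\dots,x_{n+1})=\sum_{i<j}(-1)^{i+j-1}[[\alpha^{n-2}(x_i),\alpha^{n-2}(x_j)],\psi(\dots,\widehat{x_i},\dots,\widehat{x_j},\dots)].$$ *)

(* Defs.v *)
From HB Require Import structures.
From mathcomp Require Export all_boot all_algebra.
From mathcomp Require Export boolp functions.

Set Implicit Arguments.
Unset Strict Implicit.
Unset Printing Implicit Defensive.

Import GRing.Theory.
Local Open Scope ring_scope.
Local Open Scope quotient_scope.

Section Submodule.
Variables (K : pzRingType) (V : lmodType K) (Z : submodClosed V).

Record submod := Submod { submod_val : V; _ : submod_val \in Z }.

HB.instance Definition _ := [isSub for submod_val].
HB.instance Definition _ := [Choice of submod by <:].
HB.instance Definition _ := [SubChoice_isSubLmodule of submod by <:].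

End Submodule.

(* [subquot Z B] is the module Z / (Z :&: B), i.e. the usual Z / B as soon as
   B is contained in Z. *)
Section Subquotient.
Variables (K : pzRingType) (V : lmodType K) (Z B : submodClosed V).

Definition submod_in : {pred submod Z} := [pred z | val z \in B].

Lemma submod_in_closed : submod_closed submod_in.
Proof.
split=> [|a x y xB yB]; rewrite -topredE /= /submod_in /=.
  exact: rpred0.
by apply: rpredD; [exact: rpredZ | exact: yB].
Qed.

HB.instance Definition _ :=
  GRing.isSubmodClosed.Build K (submod Z) submod_in submod_in_closed.

Definition subquot := Quotient.quot submod_in.

HB.instance Definition _ := GRing.Zmodule.on subquot.
HB.instance Definition _ :=
  EqQuotient.copy subquot (Quotient.quot submod_in).

Definition cls : submod Z -> subquot := \pi.

Lemma cls_surj q : exists x, cls x = q.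
Proof. by exists (repr q); rewrite /cls reprK. Qed.

Lemma cls_eq x y : (cls x == cls y) = (val (x - y) \in B).
Proof. by rewrite -[RHS]/(x - y \in submod_in) Quotient.idealrBE. Qed.

Lemma clsD : {morph cls : x y / x + y}.
Proof. exact: Quotient.pi_add. Qed.

Definition subquot_scale (a : K) (q : subquot) : subquot := cls (a *: repr q).

Lemma subquot_scaleE a x : subquot_scale a (cls x) = cls (a *: x).
Proof.
apply/eqP; rewrite cls_eq -scalerBr [val _]linearZ rpredZ //.
by rewrite -cls_eq /cls reprK.
Qed.

Lemma subquot_scaleA a b q :
  subquot_scale a (subquot_scale b q) = subquot_scale (a * b) q.
Proof. by have [x <-] := cls_surj q; rewrite !subquot_scaleE scalerA. Qed.

Lemma subquot_scale1 : left_id 1 subquot_scale.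
Proof. by move=> q; have [x <-] := cls_surj q; rewrite subquot_scaleE scale1r. Qed.

Lemma subquot_scaleDr : right_distributive subquot_scale +%R.
Proof.
move=> a p q; have [x <-] := cls_surj p; have [y <-] := cls_surj q.
by rewrite -clsD !subquot_scaleE -clsD scalerDr.
Qed.

Lemma subquot_scaleDl q :
  {morph subquot_scale^~ q : a b / a + b >-> a + b}.
Proof.
move=> a b; have [x <-] := cls_surj q.
by rewrite !subquot_scaleE -clsD scalerDl.
Qed.

HB.instance Definition _ := GRing.Zmodule_isLmodule.Build K subquot
  subquot_scaleA subquot_scale1 subquot_scaleDr subquot_scaleDl.

Lemma cls_linear : linear cls.
Proof. by move=> a x y; rewrite clsD -subquot_scaleE. Qed.

HB.instance Definition _ :=
  GRing.isLinear.Build K (submod Z) subquot _ cls cls_linear.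

End Subquotient.

Arguments cls {K V Z B} _.

Section HomLie.
Variables (K : fieldType) (g : vectType K).
Variables (nu : {bilinear g -> g -> g}) (alpha : 'End(g)).

Definition hom_lie : Prop :=
  [/\ forall x y, nu x y = - nu y x,
      forall x y z, nu (nu x y) (alpha z) + nu (nu y z) (alpha x)
                    + nu (nu z x) (alpha y) = 0
    & forall x y, alpha (nu x y) = nu (alpha x) (alpha y)].

(* [U, W] is spanned by the brackets of basis vectors, by bilinearity. *)
Definition bracketv (U W : {vspace g}) : {vspace g} :=
  <<[seq nu x y | x <- vbasis U, y <- vbasis W]>>%VS.

Definition hom_lie_simple : Prop :=
  [/\ alpha != 0, bracketv fullv fullv = fullv, fullv != 0%VS :> {vspace g}
    & forall I : {vspace g}, (alpha @: I <= I)%VS ->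
        (bracketv I fullv <= I)%VS -> I = 0%VS \/ I = fullv].

Definition Der : {pred 'End(g)} := fun phi =>
  `[< forall x y, phi (nu x y) = nu (phi x) y + nu x (phi y) >].

Definition Der_alpha : {pred 'End(g)} :=
  [predI Der & [pred phi | (alpha \o phi == phi \o alpha)%VF]].

Definition d_alpha (phi : 'End(g)) : 'End(g) :=
  (alpha \o phi)%VF - (phi \o alpha)%VF.

Definition alpha_Der : {pred 'End(g)} := fun h =>
  `[< exists2 phi, phi \in Der & h = (alpha \o phi)%VF >].

Definition d_alpha_Der : {pred 'End(g)} := fun h =>
  `[< exists2 phi, phi \in Der & h = d_alpha phi >].

Lemma Der_closed : submod_closed Der.
Proof.
split=> [|a f h /asboolP fD /asboolP hD]; apply/asboolP => x y.
  by rewrite !lfunE /= linear0l linear0r addr0.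
rewrite !lfunE /= !lfunE /= fD hD linearDl linearDr linearZl linearZr /=.
by rewrite scalerDr addrACA.
Qed.

HB.instance Definition _ :=
  GRing.isSubmodClosed.Build K 'End(g) Der Der_closed.

Lemma Der_alpha_closed : submod_closed Der_alpha.
Proof.
split=> [|a f h]; rewrite !inE ?rpred0 ?comp_lfun0r ?comp_lfun0l ?eqxx //.
move=> /andP[fD /eqP fa] /andP[hD /eqP ha]; rewrite rpredD ?rpredZ //=.
by rewrite comp_lfunDr comp_lfunDl -comp_lfunZr -comp_lfunZl fa ha.
Qed.

HB.instance Definition _ :=
  GRing.isSubmodClosed.Build K 'End(g) Der_alpha Der_alpha_closed.

Lemma alpha_Der_closed : submod_closed alpha_Der.
Proof.
split=> [|a _ _ /asboolP[f fD ->] /asboolP[h hD ->]]; apply/asboolP.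
  by exists 0; rewrite ?rpred0 ?comp_lfun0r.
by exists (a *: f + h); rewrite ?rpredD ?rpredZ // comp_lfunDr -comp_lfunZr.
Qed.

HB.instance Definition _ :=
  GRing.isSubmodClosed.Build K 'End(g) alpha_Der alpha_Der_closed.

Lemma d_alpha_Der_closed : submod_closed d_alpha_Der.
Proof.
split=> [|a _ _ /asboolP[f fD ->] /asboolP[h hD ->]]; apply/asboolP.
  by exists 0; rewrite ?rpred0 // /d_alpha comp_lfun0r comp_lfun0l subr0.
exists (a *: f + h); rewrite ?rpredD ?rpredZ // /d_alpha.
rewrite comp_lfunDr comp_lfunDl -comp_lfunZr -comp_lfunZl.
by rewrite scalerBr opprD addrACA.
Qed.

HB.instance Definition _ :=
  GRing.isSubmodClosed.Build K 'End(g) d_alpha_Der d_alpha_Der_closed.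

(* Hom(Λ^n g, g) is the space of alternating n-linear maps g^n -> g, except
   that it is 0 for n = 0. *)
Definition Alt n : {pred ('I_n -> g) -> g} := fun f => `[<
  if n is 0 then f = 0 else
  (forall (i : 'I_n) (x : 'I_n -> g) (a : K) (u v : g),
     f [eta x with i |-> a *: u + v] =
       a *: f [eta x with i |-> u] + f [eta x with i |-> v])
  /\ (forall (x : 'I_n -> g) (i j : 'I_n), i != j -> x i = x j -> f x = 0) >].

Lemma Alt_closed n : submod_closed (@Alt n).
Proof.
case: n => [|n].
  split=> [|a f h /asboolP -> /asboolP ->]; apply/asboolP => //.
  by rewrite scaler0 addr0.
split=> [|a f h /asboolP[fL fA] /asboolP[hL hA]]; apply/asboolP.
  by split=> // i x a u v; rewrite scaler0 addr0.
have E y : (a *: f + h) y = a *: f y + h y by [].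
split=> [i x b u v|x i j ij xij]; rewrite !E; last first.
  by rewrite (fA x i j) // (hA x i j) // scaler0 addr0.
by rewrite fL hL !scalerDr !scalerA [b * a]mulrC addrACA.
Qed.

HB.instance Definition _ n :=
  GRing.isSubmodClosed.Build K (('I_n -> g) -> g) (@Alt n) (@Alt_closed n).

Definition omit n (i : 'I_n) (x : 'I_n -> g) : 'I_n.-1 -> g :=
  fun k => x (lift i k).

(* For i < j, [lift j i] is the index of 'I_n with value i, and
   [omit i (omit j x)] is x with its entries i and j removed. *)

Definition consf n : g -> ('I_n.-1 -> g) -> 'I_n -> g :=
  match n with
  | 0 => fun _ y => y
  | m.+1 => fun a y k => oapp y a (unlift ord0 k)
  end.

(* Indices start from 0 here, so that the sign (-1)^(i+1) of the 1-based
   formulas is (-1)^i, and (-1)^(i+j-1) is (-1)^(i+j+1). *)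
Definition d_bracket (p n : nat) (f : ('I_n.-1 -> g) -> g) (x : 'I_n -> g) : g :=
  \sum_(i < n) (-1) ^+ i *: nu (iter p alpha (x i)) (f (omit i x))
  - \sum_(j < n) \sum_(i < n.-1 | (i < j)%N)
      (-1) ^+ (i + j).+1 *:
        f (consf (nu (x (lift j i)) (x j)) (alpha \o omit i (omit j x))).

Definition d_nunu n (phi : ('I_n -> g) -> g) : ('I_n.+1 -> g) -> g :=
  @d_bracket n.-1 n.+1 phi.

Definition d_alphaalpha n (psi : ('I_n.-1 -> g) -> g) : ('I_n -> g) -> g :=
  @d_bracket n.-1 n psi.

Definition d_nualpha n (phi : ('I_n -> g) -> g) (x : 'I_n -> g) : g :=
  alpha (phi x) - phi (alpha \o x).

(* The truncation of the exponent n - 2 is harmless: psi = 0 for n < 2. *)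
Definition d_alphanu n (psi : ('I_n.-1 -> g) -> g) (x : 'I_n.+1 -> g) : g :=
  \sum_(j < n.+1) \sum_(i < n | (i < j)%N)
    (-1) ^+ (i + j).+1 *:
      nu (nu (iter n.-2 alpha (x (lift j i))) (iter n.-2 alpha (x j)))
         (psi (omit i (omit j x))).

Definition precochain n : Type :=
  ((('I_n -> g) -> g) * (('I_n.-1 -> g) -> g))%type.

HB.instance Definition _ n := GRing.Lmodule.on (precochain n).

Definition cochains n : {pred precochain n} :=
  [pred c | (c.1 \in @Alt n) && (c.2 \in @Alt n.-1)].

Arguments cochains : clear implicits.

Definition coboundary n (c : precochain n) : precochain n.+1 :=
  (d_nunu c.1 - d_alphanu c.2, d_nualpha c.1 - d_alphaalpha c.2).

Lemma d_bracket_linear p n : linear (@d_bracket p n).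
Proof.
move=> a f h; apply/funext => x; rewrite /d_bracket.
have E y : (a *: f + h) y = a *: f y + h y by [].
rewrite -[RHS]/(a *: (_ - _) + (_ - _)) scalerBr addrACA -opprD.
congr (_ - _); rewrite scaler_sumr -big_split; apply: eq_bigr => j _ /=.
  by rewrite E linearPr scalerDr !scalerA mulrC.
rewrite scaler_sumr -big_split; apply: eq_bigr => i _ /=.
by rewrite E scalerDr !scalerA mulrC.
Qed.

Lemma d_nualpha_linear n : linear (@d_nualpha n).
Proof.
move=> a f h; apply/funext => x; rewrite /d_nualpha.
rewrite -[RHS]/(a *: (_ - _) + (_ - _)) scalerBr addrACA -opprD.
by rewrite -linearP.
Qed.

Lemma d_alphanu_linear n : linear (@d_alphanu n).
Proof.
move=> a f h; apply/funext => x; rewrite /d_alphanu.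
rewrite -[RHS]/(a *: (\sum_j _) + (\sum_j _)).
rewrite scaler_sumr -big_split; apply: eq_bigr => j _ /=.
rewrite scaler_sumr -big_split; apply: eq_bigr => i _ /=.
by rewrite -[(a *: f + h) _]/(a *: f _ + h _) linearPr scalerDr !scalerA mulrC.
Qed.

Lemma coboundary_linear n : linear (@coboundary n).
Proof.
move=> a [f f'] [h h']; rewrite /coboundary /d_nunu /d_alphaalpha /=.
rewrite !d_bracket_linear d_alphanu_linear d_nualpha_linear.
rewrite -[RHS]/(a *: (_ - _) + (_ - _), a *: (_ - _) + (_ - _)).
by rewrite !scalerBr !opprD; congr pair; rewrite addrACA.
Qed.

HB.instance Definition _ n :=
  GRing.isLinear.Build K (precochain n) (precochain n.+1) _ (@coboundary n)
    (@coboundary_linear n).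

Lemma cochains_closed n : submod_closed (cochains n).
Proof.
split=> [|a c e]; rewrite !inE; first by rewrite !rpred0.
move=> /andP[c1 c2] /andP[e1 e2].
by apply/andP; split; apply: rpredD; rewrite // rpredZ.
Qed.

HB.instance Definition _ n :=
  GRing.isSubmodClosed.Build K (precochain n) (cochains n)
    (@cochains_closed n).

Definition cocycles n : {pred precochain n} :=
  [pred c | (c \in cochains n) && (coboundary c == 0)].

Arguments cocycles : clear implicits.

Definition coboundaries n : {pred precochain n} :=
  match n with
  | 0 => pred1 0
  | m.+1 => fun c =>
      `[< exists2 b : precochain m, b \in cochains m & c = coboundary b >]
  end.

Arguments coboundaries : clear implicits.

Lemma cocycles_closed n : submod_closed (cocycles n).
Proof.
split=> [|a c e].
  by apply/andP; split; [exact: rpred0 | apply/eqP; exact: linear0].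
move=> /andP[cC /eqP c0] /andP[eC /eqP e0]; apply/andP; split.
  by rewrite rpredD ?rpredZ.
apply/eqP; rewrite coboundary_linear.
by rewrite [coboundary c]c0 [coboundary e]e0 scaler0 addr0.
Qed.

HB.instance Definition _ n :=
  GRing.isSubmodClosed.Build K (precochain n) (cocycles n)
    (@cocycles_closed n).

Lemma coboundaries_closed n : submod_closed (coboundaries n).
Proof.
case: n => [|n] /=.
  split=> [|a c e]; rewrite !inE // => /eqP -> /eqP ->.
  by rewrite scaler0 addr0.
split=> [|a _ _ /asboolP[b bC ->] /asboolP[e eC ->]]; apply/asboolP.
  by exists 0; rewrite ?rpred0 ?linear0.
by exists (a *: b + e); rewrite ?coboundary_linear // rpredD ?rpredZ.
Qed.

HB.instance Definition _ n :=
  GRing.isSubmodClosed.Build K (precochain n) (coboundaries n)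
    (@coboundaries_closed n).

(* The Hom-Lie identities make the coboundary square to zero, so that
   coboundaries are cocycles and [subquot] is the plain quotient. *)
Definition cohomology n := subquot (cocycles n) (coboundaries n).

HB.instance Definition _ n := GRing.Lmodule.on (cohomology n).

End HomLie.

Arguments cochains {K} g n _.
Arguments cocycles {K g} nu alpha n _.
Arguments coboundaries {K g} nu alpha n _.

(* Main.v *)
From HB Require Import structures.
Require Import Defs.
From mathcomp Require Import all_boot all_order all_algebra all_field.

Set Implicit Arguments.
Unset Strict Implicit.
Unset Printing Implicit Defensive.

Import GRing.Theory Num.Theory.
Local Open Scope ring_scope.
Local Arguments consf : simpl never.

(** A simple Hom-Lie algebra has injective [alpha], because [ker alpha] is an
    ideal.  Hence [br x y = alpha^-1 [x, y]] is a Lie bracket, of which [alpha]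
    is an automorphism.  With [tau f = alpha^-1 f (alpha x1, ..., alpha xn)] and
    [d] the Chevalley-Eilenberg differential of [br] with adjoint coefficients,
    a linear change of coordinates turns the alpha-type coboundary into
    [(f, h) |-> (tau d f, f - tau f - tau d h)], the mapping cone of [1 - tau] up
    to rescaling.

    The Killing form of [br] is nondegenerate.  Its radical is an alpha-stable
    ideal, so otherwise the form vanishes.  Then let [lambda_i] be the eigenvalues
    of [ad u] in a splitting field and [z_i] the values at them of a Q-linear
    functional.  Scaling the generalised eigenspaces by the [z_i] is a derivation
    [Y], and [tr (ad u Y) = 0] reads [sum_i dim_i z_i lambda_i = 0]; applying the
    functional, [sum_i dim_i z_i^2 = 0].  So every [ad u] is nilpotent, and
    Engel's theorem gives a nonzero centre, which is an alpha-stable ideal: the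
    bracket is zero, which contradicts perfectness.

    For dual bases [e_i], [e'_i] of the Killing form the Casimir operator of the
    adjoint representation is the identity, so that
    [f |-> sum_i [e_i, f (e'_i, -)]] contracts the Chevalley-Eilenberg complex:
    [d s + s d = 1].  It follows that the third and higher groups of the cone
    vanish, that the first is the space of derivations of [br] fixed by [tau],
    i.e. [Der_alpha], and that the second is the cokernel of [1 - tau] on the
    derivations of [br].  The cokernel of [1 - tau] on [Der(g)] is
    [alpha(Der) / d_alpha(Der)]; the two cokernels have the same dimension since
    both kernels are [Der_alpha]. *)

(** * Alternating sums over omitted arguments *)

Section AlternatingSums.
Variables (K : fieldType) (g : vectType K).

Lemma consf_ord0 n (a : g) (y : 'I_n -> g) : @consf K g n.+1 a y ord0 = a.
Proof. by rewrite /consf unlift_none. Qed.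

Lemma consf_lift n (a : g) (y : 'I_n -> g) k :
  @consf K g n.+1 a y (lift ord0 k) = y k.
Proof. by rewrite /consf liftK. Qed.

Lemma consf_eta n (x : 'I_n.+1 -> g) : @consf K g n.+1 (x ord0) (omit ord0 x) = x.
Proof.
apply/funext => k; case: (unliftP ord0 k) => [j|] ->.
  by rewrite consf_lift.
by rewrite consf_ord0.
Qed.

Lemma consf_ind n (Q : ('I_n.+1 -> g) -> Prop) :
  (forall a y, Q (@consf K g n.+1 a y)) -> forall x, Q x.
Proof. by move=> QP x; rewrite -(consf_eta x). Qed.

Lemma omit_ord0 n (a : g) (y : 'I_n -> g) :
  omit ord0 (@consf K g n.+1 a y) = y.
Proof. by apply/funext => k; rewrite /omit consf_lift. Qed.

Lemma omit_lift n (a : g) (y : 'I_n -> g) (j : 'I_n) :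
  omit (lift ord0 j) (@consf K g n.+1 a y) = consf a (omit j y).
Proof.
case: n y j => [|n] y j; first by case: j.
apply/funext => k; case: (unliftP ord0 k) => [l|] ->.
  rewrite consf_lift /omit -[RHS](consf_lift a); congr (consf _ _ _).
  by apply: val_inj; rewrite /= /bump /= !add1n ltnS addnS.
rewrite consf_ord0 /omit -[RHS](consf_ord0 a y); congr (consf _ _ _).
exact: val_inj.
Qed.

Lemma comp_consf (h : g -> g) n (a : g) (y : 'I_n.-1 -> g) (hE : (0 < n)%N) :
  h \o consf a y = @consf K g n (h a) (h \o y).
Proof.
case: n y hE => // n y _; apply/funext => k /=.
by rewrite /consf; case: unlift.
Qed.

(** [ssum] and [psum] are the two shapes of sum in the coboundary formulas, with one and with two
    omitted arguments. The summand stays abstract so that expansion along the first argument is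
    proved once. *)
Definition ssum n (F : g -> ('I_n.-1 -> g) -> g) (x : 'I_n -> g) : g :=
  \sum_(j < n) (-1) ^+ j *: F (x j) (omit j x).

Definition psum n (G : g -> g -> ('I_n.-2 -> g) -> g) (x : 'I_n -> g) : g :=
  \sum_(j < n) \sum_(i < n.-1 | (i < j)%N)
     (-1) ^+ (i + j).+1 *: G (x (lift j i)) (x j) (omit i (omit j x)).

Lemma ssum0 F (x : 'I_0 -> g) : ssum F x = 0.
Proof. by rewrite /ssum big_ord0. Qed.

Lemma psum0 G (x : 'I_0 -> g) : psum G x = 0.
Proof. by rewrite /psum big_ord0. Qed.

(** The term omitting the first argument splits off; the other indices shift by one, whence the
    minus sign. This recursion lets the identities of the complex be proved by induction on the
    degree. *)
Lemma ssum_consf n (F : g -> ('I_n -> g) -> g) (a : g) (y : 'I_n -> g) :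
  @ssum n.+1 F (@consf K g n.+1 a y) =
    F a y - ssum (fun b z => F b (consf a z)) y.
Proof.
rewrite /ssum big_ord_recl expr0 scale1r omit_ord0 consf_ord0 -sumrN.
congr (_ + _); apply: eq_bigr => j _.
by rewrite consf_lift omit_lift lift0 exprS mulN1r scaleNr.
Qed.

(** Pairs containing the first index have sign [(-1)^(j+2)] and form the [ssum]; in the other pairs
    both indices shift, so the sign is unchanged. *)
Lemma psum_consf n (G : g -> g -> ('I_n.-1 -> g) -> g) (a : g) (y : 'I_n -> g) :
  @psum n.+1 G (@consf K g n.+1 a y) =
    ssum (G a) y + psum (fun b c z => G b c (consf a z)) y.
Proof.
rewrite /psum big_ord_recl [X in X + _]big_pred0 // add0r /ssum -big_split.
case: n G y => [|n] G y; first by rewrite !big_ord0.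
apply: eq_bigr => j _.
rewrite big_mkcond big_ord_recl consf_lift; congr (_ + _).
  have -> : lift (lift ord0 j) ord0 = ord0 by exact: val_inj.
  by rewrite consf_ord0 omit_lift omit_ord0 lift0 !exprS !mulN1r opprK.
rewrite [RHS]big_mkcond; apply: eq_bigr => i _.
rewrite !lift0 ltnS; case: ifP => // _.
have -> : lift (lift ord0 j) (lift ord0 i) = lift ord0 (lift j i).
  by apply: val_inj; rewrite /= /bump /= !add1n ltnS addnS.
rewrite consf_lift !omit_lift addSn addnS !exprS !mulN1r !opprK.
by [].
Qed.

Lemma eq_ssum n (F F' : g -> ('I_n.-1 -> g) -> g) x :
  (forall a y, F a y = F' a y) -> ssum F x = ssum F' x.
Proof. by move=> FF; apply: eq_bigr => j _; rewrite FF. Qed.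

Lemma eq_psum n (G G' : g -> g -> ('I_n.-2 -> g) -> g) x :
  (forall a b y, G a b y = G' a b y) -> psum G x = psum G' x.
Proof.
by move=> GG; apply: eq_bigr => j _; apply: eq_bigr => i _; rewrite GG.
Qed.

Lemma ssumP n k (F F' : g -> ('I_n.-1 -> g) -> g) x :
  ssum (fun a y => k *: F a y + F' a y) x = k *: ssum F x + ssum F' x.
Proof.
rewrite /ssum scaler_sumr -big_split; apply: eq_bigr => j _ /=.
by rewrite scalerDr !scalerA mulrC.
Qed.

Lemma psumP n k (G G' : g -> g -> ('I_n.-2 -> g) -> g) x :
  psum (fun a b y => k *: G a b y + G' a b y) x = k *: psum G x + psum G' x.
Proof.
rewrite /psum scaler_sumr -big_split; apply: eq_bigr => j _ /=.
rewrite scaler_sumr -big_split; apply: eq_bigr => i _ /=.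
by rewrite scalerDr !scalerA mulrC.
Qed.

Lemma ssumB n (F F' : g -> ('I_n.-1 -> g) -> g) x :
  ssum (fun a y => F a y - F' a y) x = ssum F x - ssum F' x.
Proof.
rewrite /ssum -sumrB; apply: eq_bigr => j _.
by rewrite scalerBr.
Qed.

Lemma ssumD n (F F' : g -> ('I_n.-1 -> g) -> g) x :
  ssum (fun a y => F a y + F' a y) x = ssum F x + ssum F' x.
Proof.
rewrite /ssum -big_split; apply: eq_bigr => j _.
by rewrite scalerDr.
Qed.

Lemma psumN n (G : g -> g -> ('I_n.-2 -> g) -> g) x :
  psum (fun a b y => - G a b y) x = - psum G x.
Proof.
rewrite /psum -sumrN; apply: eq_bigr => j _; rewrite -sumrN.
by apply: eq_bigr => i _; rewrite scalerN.
Qed.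

Lemma linear_ssum (h : {linear g -> g}) n (F : g -> ('I_n.-1 -> g) -> g) x :
  h (ssum F x) = ssum (fun a y => h (F a y)) x.
Proof.
by rewrite /ssum linear_sum; apply: eq_bigr => j _; rewrite linearZ.
Qed.

Lemma linear_psum (h : {linear g -> g}) n (G : g -> g -> ('I_n.-2 -> g) -> g) x :
  h (psum G x) = psum (fun a b y => h (G a b y)) x.
Proof.
rewrite /psum linear_sum; apply: eq_bigr => j _.
by rewrite linear_sum; apply: eq_bigr => i _; rewrite linearZ.
Qed.

(** Removing two arguments in the other order flips the relative sign. The swap exchanges the terms
    that involve the first argument; induction handles the others. *)
Lemma ssum_swap n (G : g -> g -> ('I_n.-2 -> g) -> g) x :
  @ssum n (fun a y => ssum (fun b z => G a b z) y) x =
  - @ssum n (fun a y => ssum (fun b z => G b a z) y) x.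
Proof.
elim: n G x => [|n IHn] G x; first by rewrite !ssum0 oppr0.
elim/consf_ind: x => a y; rewrite !ssum_consf.
case: n IHn G y => [|n] IHn G y; first by rewrite !ssum0 !subr0 oppr0.
under [X in _ - X]eq_ssum => b z do rewrite ssum_consf.
under [X in - (_ - X)]eq_ssum => b z do rewrite ssum_consf.
by rewrite !ssumB [in LHS]IHn !opprB addrA.
Qed.

End AlternatingSums.

(** * The Chevalley-Eilenberg differential *)

Section Alternating.
Variables (K : fieldType) (g : vectType K).

Lemma subfctE (T : Type) (f f' : T -> g) x : (f - f') x = f x - f' x.
Proof. by []. Qed.

Lemma psum1 (G : g -> g -> ('I_0 -> g) -> g) (x : 'I_1 -> g) :
  @psum _ _ 1 G x = 0.
Proof. by rewrite /psum big_ord_recl big_ord0 addr0 big_ord0. Qed.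

Definition contract n (a : g) (f : ('I_n -> g) -> g) : ('I_n.-1 -> g) -> g :=
  fun z => f (consf a z).

(** This recursive form suits expansion by [consf]. It agrees with [Alt] in positive degree
    ([AltP]); in degree 0 it imposes nothing, whereas [Alt] is zero there. *)
Fixpoint alternating n : (('I_n -> g) -> g) -> Prop :=
  match n with
  | 0 => fun _ => True
  | m.+1 => fun f =>
    [/\ forall a, alternating (@contract m.+1 a f),
        forall y k u v, f (@consf K g m.+1 (k *: u + v) y) =
          k *: f (@consf K g m.+1 u y) + f (@consf K g m.+1 v y)
      & forall a z, (0 < m)%N -> f (@consf K g m.+1 a (consf a z)) = 0]
  end.

Lemma alternating_contract n a (f : ('I_n -> g) -> g) :
  alternating f -> alternating (contract a f).
Proof. by case: n f => // n f [fC _ _]; apply: fC. Qed.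

Lemma alternating_linear n (f : ('I_n.+1 -> g) -> g) y : alternating f ->
  linear (fun a => f (@consf K g n.+1 a y)).
Proof. by case=> _ fL _ k u v; apply: fL. Qed.

Lemma alternatingD n (f : ('I_n.+1 -> g) -> g) a b y : alternating f ->
  f (@consf K g n.+1 (a + b) y) =
  f (@consf K g n.+1 a y) + f (@consf K g n.+1 b y).
Proof.
by move=> fA; have := alternating_linear y fA 1 a b; rewrite /= !scale1r.
Qed.

Lemma alternating_swap n (f : ('I_n.+1 -> g) -> g) a b z : alternating f ->
  (0 < n)%N ->
  f (@consf K g n.+1 b (consf a z)) = - f (@consf K g n.+1 a (consf b z)).
Proof.
case: n f z => // n f z fA _; apply/eqP; rewrite -addr_eq0; apply/eqP.
have [fC _ f0] := fA.
have L c u v : f (@consf K g n.+2 c (@consf K g n.+1 (u + v) z)) =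
   f (@consf K g n.+2 c (@consf K g n.+1 u z)) +
   f (@consf K g n.+2 c (@consf K g n.+1 v z)).
  exact: alternatingD (fC c).
have := f0 (a + b) z isT; rewrite L !alternatingD // !f0 // add0r addr0.
by rewrite addrC.
Qed.

Lemma alternating_ext n (f f' : ('I_n -> g) -> g) :
  f =1 f' -> alternating f -> alternating f'.
Proof. by move=> /funext ->. Qed.

Lemma alternatingP n k (f f' : ('I_n -> g) -> g) :
  alternating f -> alternating f' -> alternating (k *: f + f').
Proof.
elim: n k f f' => [//|n IHn] k f f' [fC fL f0] [f'C f'L f'0].
split=> [a|y c u v|a z n0].
- exact: IHn (fC a) (f'C a).
- rewrite -![(k *: f + f') _]/(k *: f _ + f' _) fL f'L !scalerDr !scalerA.
  by rewrite [k * c]mulrC addrACA.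
- by rewrite -![(k *: f + f') _]/(k *: f _ + f' _) f0 // f'0 // scaler0 addr0.
Qed.

Lemma alternating0 n : alternating (0 : ('I_n -> g) -> g).
Proof.
elim: n => [//|n IHn]; split=> [a|y c u v|a z n0] //.
by rewrite scaler0 addr0.
Qed.

Lemma alternating_comp (h : {linear g -> g}) n (f : ('I_n -> g) -> g) :
  alternating f -> alternating (fun x => h (f x)).
Proof.
elim: n f => [//|n IHn] f [fC fL f0]; split=> [a|y k u v|a z n0].
- exact: IHn (fC a).
- by rewrite fL linearP.
- by rewrite f0 // linear0.
Qed.

Lemma alternating_precomp (h : {linear g -> g}) n (f : ('I_n -> g) -> g) :
  alternating f -> alternating (fun x => f (h \o x)).
Proof.
elim: n f => [//|n IHn] f [fC fL f0]; split=> [a|y k u v|a z n0].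
- apply: alternating_ext (IHn _ (fC (h a))) => z /=.
  by rewrite /contract comp_consf.
- by rewrite !comp_consf // linearP fL.
- by rewrite !comp_consf // f0.
Qed.

End Alternating.

Section ChevalleyEilenberg.
Variables (K : fieldType) (g : vectType K) (br : {bilinear g -> g -> g}).
Hypothesis brJ : forall x y z, br x (br y z) = br (br x y) z + br y (br x z).

(* [ce1 f - ce2 f] is the Chevalley-Eilenberg differential: [ce1] gathers the
   terms in which the algebra acts on the values of [f], and [ce2] those in
   which two arguments are bracketed. *)
Definition ce1 n (f : ('I_n.-1 -> g) -> g) : ('I_n -> g) -> g :=
  ssum (fun b z => br b (f z)).

Definition ce2 n (f : ('I_n.-1 -> g) -> g) : ('I_n -> g) -> g :=
  psum (fun b c z => f (consf (br b c) z)).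

Definition ce n (f : ('I_n.-1 -> g) -> g) : ('I_n -> g) -> g := ce1 f - ce2 f.

(** This is the square of [ce1] and, up to a power of [alpha], the term [d_alphanu]. *)
Definition curv n (f : ('I_n.-2 -> g) -> g) : ('I_n -> g) -> g :=
  psum (fun b c z => br (br b c) (f z)).

(** For alternating [f] this is the action of [a] on the arguments: the sum over j of [f] with [x_j]
    replaced by [[a, x_j]]. The sign moves the bracket from slot j to the first slot. *)
Definition cobr n a (f : ('I_n -> g) -> g) : ('I_n -> g) -> g :=
  ssum (fun b z => f (consf (br a b) z)).

Lemma ce1_consf n (f : ('I_n -> g) -> g) a y :
  @ce1 n.+1 f (@consf K g n.+1 a y) = br a (f y) - ce1 (contract a f) y.
Proof. exact: ssum_consf. Qed.

Lemma curv_consf n (f : ('I_n.-1 -> g) -> g) a y :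
  @curv n.+1 f (@consf K g n.+1 a y) =
    ssum (fun b z => br (br a b) (f z)) y + curv (contract a f) y.
Proof. exact: psum_consf. Qed.

Lemma ce1P n k (f f' : ('I_n.-1 -> g) -> g) :
  ce1 (k *: f + f') = k *: ce1 f + ce1 f'.
Proof.
apply/funext => x; rewrite -[RHS]/(k *: ce1 f x + ce1 f' x) -ssumP.
by apply: eq_ssum => b z; rewrite -linearP.
Qed.

Lemma ce2P n k (f f' : ('I_n.-1 -> g) -> g) :
  ce2 (k *: f + f') = k *: ce2 f + ce2 f'.
Proof. by apply/funext => x; rewrite -[RHS]/(k *: ce2 f x + ce2 f' x) -psumP. Qed.

HB.instance Definition _ n :=
  GRing.isLinear.Build K _ _ _ (@ce1 n) (@ce1P n).
HB.instance Definition _ n :=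
  GRing.isLinear.Build K _ _ _ (@ce2 n) (@ce2P n).

Lemma ce1B n (f f' : ('I_n.-1 -> g) -> g) x :
  ce1 (f - f') x = ce1 f x - ce1 f' x.
Proof. by rewrite linearB. Qed.

Lemma ce2B n (f f' : ('I_n.-1 -> g) -> g) x :
  ce2 (f - f') x = ce2 f x - ce2 f' x.
Proof. by rewrite linearB. Qed.

Lemma ceP n : linear (@ce n).
Proof.
by move=> k f f'; rewrite /ce ce1P ce2P scalerBr opprD addrACA.
Qed.

HB.instance Definition _ n :=
  GRing.isLinear.Build K _ _ _ (@ce n) (@ceP n).

Lemma alternating_ce1 n (f : ('I_n.-1 -> g) -> g) :
  alternating f -> alternating (ce1 f).
Proof.
elim: n f => [//|n IHn] f fA; split=> [a|y k u v|a z].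
- have := alternating_comp (br a) fA.
  have := IHn _ (alternating_contract a fA) => /(alternatingP (-1)) /[apply].
  apply: alternating_ext => y; rewrite /contract ce1_consf.
  by rewrite -[LHS]/(-1 *: _ + _) scaleN1r addrC.
- rewrite !ce1_consf linearPl /= scalerBr -!addrA; congr (_ + _).
  rewrite [RHS]addrCA; congr (_ + _).
  case: n f {IHn} y fA => [|n] f y fA.
    by rewrite /ce1 !ssum0 !(oppr0, scaler0, addr0).
  have -> : contract (k *: u + v) f = k *: contract u f + contract v f.
    by apply/funext => z; apply: (alternating_linear z fA).
  by rewrite ce1P opprD.
(* On a repeated first argument the two action terms cancel; what remains is [ce1] of a double
   contraction by [a], which is zero. *)
- case: n f {IHn} z fA => // n f z fA _.
  rewrite !ce1_consf subKr; case: n f z fA => [|n] f z fA.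
    by rewrite /ce1 ssum0.
  have [_ _ f0] := fA.
  have -> : contract a (contract a f) = 0 by apply/funext => w; apply: f0.
  by rewrite linear0.
Qed.

Lemma ce2_consf n (f : ('I_n -> g) -> g) a y : alternating f ->
  @ce2 n.+1 f (@consf K g n.+1 a y) = cobr a f y - ce2 (contract a f) y.
Proof.
rewrite /ce2 psum_consf => fA; congr (_ + _).
case: n f y fA => [|[|n]] f y fA; rewrite ?psum0 ?psum1 ?oppr0 //.
rewrite -psumN; apply: eq_psum => b c z.
exact: alternating_swap.
Qed.

(** Antisymmetrising two successive actions on the values leaves their commutator, which by Jacobi
    is the action of the bracket. *)
Lemma ce1_ce1 n (f : ('I_n.-2 -> g) -> g) : ce1 (@ce1 n.-1 f) = curv f.
Proof.
elim: n f => [|n IHn] f; apply/funext; first by move=> x; rewrite /curv psum0 /ce1 ssum0.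
elim/consf_ind => a y; rewrite ce1_consf curv_consf.
rewrite -(IHn (contract a f)).
case: n f y {IHn} => [|n] f y.
  by rewrite /ce1 !ssum0 linear0 subrr addr0.
have -> : contract a (@ce1 n.+1 f) = (fun z => br a (f z)) - ce1 (contract a f).
  by apply/funext => z; rewrite /contract ce1_consf.
rewrite linearB /= subfctE opprB addrCA [RHS]addrC; congr (_ + _).
rewrite /ce1 linear_ssum -ssumB; apply: eq_ssum => b z.
by rewrite -[RHS](addrK (br b (br a (f z)))) -brJ.
Qed.

Lemma cobr_ce1 n a (f : ('I_n.-1 -> g) -> g) y :
  cobr a (@ce1 n f) y = ce1 (cobr a f) y + ssum (fun b z => br (br a b) (f z)) y.
Proof.
case: n f y => [|n] f y; first by rewrite /cobr /ce1 !ssum0 addr0.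
rewrite {1}/cobr; under eq_ssum => b z do rewrite ce1_consf.
rewrite ssumB addrC /ce1 /contract ssum_swap opprK; congr (_ + _).
by apply: eq_ssum => b z; rewrite /cobr linear_ssum.
Qed.

(** Together with [ce1_ce1] this cancels the terms of the squared differential in which the algebra
    acts on values. In the induction, the terms in [br a f] and in [ce1 (cobr a f)] cancel, and the
    part of [curv] containing [a] comes from [cobr_ce1]. *)
Lemma ce1_ce2 n (f : ('I_n.-2 -> g) -> g) : alternating f ->
  ce1 (@ce2 n.-1 f) + ce2 (@ce1 n.-1 f) = curv f.
Proof.
elim: n f => [|n IHn] f fA; apply/funext.
  by move=> x; rewrite /curv psum0 -[LHS]/(_ + _) /ce1 /ce2 ssum0 psum0 addr0.
elim/consf_ind => a y; rewrite curv_consf -(IHn (contract a f)); last first.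
  exact: alternating_contract.
rewrite -[LHS]/(ce1 _ _ + ce2 _ _) -[X in _ = _ + X]/(ce1 _ _ + ce2 _ _).
rewrite ce1_consf ce2_consf; last exact: alternating_ce1.
case: n f y {IHn} fA => [|n] f y fA.
  by rewrite /cobr /ce1 /ce2 !psum0 !ssum0 linear0 !subr0 !addr0.
have -> : contract a (@ce1 n.+1 f) = (fun z => br a (f z)) - ce1 (contract a f).
  by apply/funext => z; rewrite /contract ce1_consf.
have -> : contract a (@ce2 n.+1 f) = cobr a f - ce2 (contract a f).
  by apply/funext => z; rewrite /contract ce2_consf.
rewrite ce1B ce2B cobr_ce1 {1}/ce2 linear_psum !opprB.
rewrite -[psum _ y]/(ce2 (fun z => br a (f z)) y).
by rewrite [LHS](AC ((1*2)*(2*2)) ((1*7)*(3*4)*(5*(2*6)))) /= addNr subrr !add0r.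
Qed.

End ChevalleyEilenberg.

(** * Agreement of the recursive and the usual notion of alternating map *)

Section AltAlternating.
Variables (K : fieldType) (g : vectType K).

Lemma consf_with0 n (a b : g) (y : 'I_n -> g) :
  ([eta @consf K g n.+1 b y with ord0 |-> a] : 'I_n.+1 -> g) = @consf K g n.+1 a y.
Proof.
apply/funext => i /=; case: (unliftP ord0 i) => [j|] -> /=.
  by rewrite !consf_lift.
by rewrite consf_ord0.
Qed.

Lemma consf_with_lift n (a u : g) (y : 'I_n -> g) j :
  ([eta @consf K g n.+1 a y with lift ord0 j |-> u] : 'I_n.+1 -> g) =
  @consf K g n.+1 a [eta y with j |-> u].
Proof.
apply/funext => i /=; case: (unliftP ord0 i) => [k|] -> /=.
  by rewrite !consf_lift /= (inj_eq lift_inj).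
by rewrite !consf_ord0.
Qed.

Let multilinear n (f : ('I_n -> g) -> g) :=
  forall (i : 'I_n) (x : 'I_n -> g) (a : K) (u v : g),
     f [eta x with i |-> a *: u + v] =
       a *: f [eta x with i |-> u] + f [eta x with i |-> v].

Let alternates n (f : ('I_n -> g) -> g) :=
  forall (x : 'I_n -> g) (i j : 'I_n), i != j -> x i = x j -> f x = 0.

Lemma multilinear_alternates n (f : ('I_n -> g) -> g) :
  multilinear f -> alternates f -> alternating f.
Proof.
elim: n f => [//|n IHn] f fL fA; split=> [a|y k u v|a z].
- apply: IHn => [i x k u v|x i j ij xij]; rewrite /contract.
    by rewrite -!consf_with_lift fL.
  apply: (fA _ (lift ord0 i) (lift ord0 j)); rewrite ?(inj_eq lift_inj) //.
  by rewrite !consf_lift.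
- by have := fL ord0 (@consf K g n.+1 0 y) k u v; rewrite !consf_with0.
- case: n f z fL fA {IHn} => // n f z fL fA _.
  apply: (fA _ ord0 (lift ord0 ord0)) => //.
  by rewrite consf_ord0 consf_lift consf_ord0.
Qed.

(** Swapping the first two arguments and contracting by the new first one brings [a] closer to its
    copy. *)
Lemma alternating_repeat n (f : ('I_n.+1 -> g) -> g) (a : g) y k :
  alternating f -> y k = a -> f (@consf K g n.+1 a y) = 0.
Proof.
elim: n f y k => [|n IHn] f y k; first by case: k.
elim/consf_ind: y => b w fA; have [fC _ f0] := fA.
case: (unliftP ord0 k) => [j|] ->.
  rewrite consf_lift => wj; rewrite alternating_swap //.
  by rewrite -[f _]/(contract b f _) (IHn _ w j) ?oppr0 //; apply: fC.
by rewrite consf_ord0 => <-; apply: f0.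
Qed.

Lemma alternating_multilinear n (f : ('I_n -> g) -> g) :
  alternating f -> multilinear f.
Proof.
elim: n f => [|n IHn] f fA i; first by case: i.
elim/consf_ind=> b w a u v; have [fC fL _] := fA.
case: (unliftP ord0 i) => [j|] ->; last by rewrite !consf_with0 fL.
by rewrite !consf_with_lift; exact: (IHn (contract b f) (fC b)).
Qed.

Lemma alternating_alternates n (f : ('I_n -> g) -> g) :
  alternating f -> alternates f.
Proof.
elim: n f => [|n IHn] f fA; first by move=> x [].
have [fC fL _] := fA.
elim/consf_ind=> b w i j.
case: (unliftP ord0 i) => [i'|] ->; case: (unliftP ord0 j) => [j'|] ->.
- rewrite (inj_eq lift_inj) !consf_lift => ij wij.
  exact: (IHn (contract b f) (fC b) w i' j').
- by rewrite consf_lift consf_ord0 => _; apply: alternating_repeat.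
- by rewrite consf_lift consf_ord0 => _ /esym; apply: alternating_repeat.
- by rewrite eqxx.
Qed.

Lemma AltP n (f : ('I_n.+1 -> g) -> g) : (f \in @Alt K g n.+1) <-> alternating f.
Proof.
split=> [/asboolP[fL fA]|fA]; first exact: multilinear_alternates.
apply/asboolP; split.
  exact: alternating_multilinear.
exact: alternating_alternates.
Qed.

Lemma Alt0P (f : ('I_0 -> g) -> g) : (f \in @Alt K g 0) <-> f = 0.
Proof. by split=> /asboolP. Qed.

Lemma Alt_alternating n (f : ('I_n -> g) -> g) :
  f \in @Alt K g n -> alternating f.
Proof. by case: n f => // n f /AltP. Qed.

End AltAlternating.

(** * The Casimir homotopy of the Chevalley-Eilenberg complex *)

Section Homotopy.
Variables (K : fieldType) (g : vectType K) (br : {bilinear g -> g -> g}).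
Hypothesis brJ : forall x y z, br x (br y z) = br (br x y) z + br y (br x z).
Variables (I : finType) (e e' : I -> g).
Hypothesis dual_invariant : forall (F : g -> g) x, linear F ->
  \sum_i (br (br (e i) x) (F (e' i)) + br (e i) (F (br (e' i) x))) = 0.
Hypothesis casimir1 : forall x, \sum_i br (e i) (br (e' i) x) = x.

Definition homotopy n (f : ('I_n -> g) -> g) : ('I_n.-1 -> g) -> g :=
  fun z => \sum_i br (e i) (f (consf (e' i) z)).

Lemma homotopyE n (f : ('I_n -> g) -> g) :
  homotopy f = \sum_i (fun z => br (e i) (contract (e' i) f z)).
Proof. by apply/funext => z; rewrite fct_sumE. Qed.

Lemma homotopyP n : linear (@homotopy n).
Proof.
move=> k f f'; apply/funext => z.
rewrite -[RHS]/(k *: homotopy f z + homotopy f' z) /homotopy scaler_sumr.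
by rewrite -big_split; apply: eq_bigr => i _; rewrite /= -linearP.
Qed.

Lemma alternating_homotopy n (f : ('I_n -> g) -> g) :
  alternating f -> alternating (homotopy f).
Proof.
move=> fA; rewrite homotopyE.
elim/big_ind: _ => [|f1 f2 f1A f2A|i _].
- exact: alternating0.
- by rewrite -[f1]scale1r; apply: alternatingP.
- exact/alternating_comp/alternating_contract.
Qed.

Lemma br_ce1 a n (f : ('I_n.-1 -> g) -> g) y :
  br a (ce1 br f y) =
  ce1 br (fun z => br a (f z)) y + ssum (fun b z => br (br a b) (f z)) y.
Proof.
rewrite /ce1 linear_ssum -ssumD; apply: eq_ssum => b z.
by rewrite addrC -brJ.
Qed.

Lemma br_ce2 a n (f : ('I_n.-1 -> g) -> g) y :
  br a (ce2 br f y) = ce2 br (fun z => br a (f z)) y.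
Proof. by rewrite /ce2 linear_psum. Qed.

(** What does not cancel in the sum is the Casimir operator applied to [f x], minus the terms [T i]
    in which some [x_j] is bracketed with [e i] or [e' i]. For each j these sum to zero by
    invariance of the tensor of the [e i] and [e' i]. *)
Lemma homotopy_ce n (f : ('I_n.+1 -> g) -> g) : alternating f ->
  ce br (homotopy f) + @homotopy n.+2 (@ce _ _ br n.+2 f) = f.
Proof.
move=> fA; apply/funext => x.
rewrite -[LHS]/(ce br (homotopy f) x + @homotopy n.+2 (@ce _ _ br n.+2 f) x).
rewrite homotopyE linear_sum fct_sumE /homotopy -big_split /=.
pose T i := ssum (fun b z => br (br (e i) b) (f (consf (e' i) z))) x
   + br (e i) (cobr br (e' i) f x).
rewrite (eq_bigr (fun i => br (e i) (br (e' i) (f x)) - T i)); last first.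
  move=> i _; rewrite {2}/ce !subfctE ce1_consf ce2_consf // /T.
  rewrite !linearB /= br_ce1 br_ce2 /ce subfctE.
  by rewrite opprK !opprD (AC (2*((1*2)*2)) ((1*4)*(7*2)*(3*(5*6)))) /= !subrr !add0r.
rewrite sumrB casimir1 (_ : \sum_i T i = 0) ?subr0 //.
rewrite big_split /= /ssum exchange_big /=.
under [X in _ + X]eq_bigr => i _ do rewrite linear_sum.
rewrite [X in _ + X]exchange_big -big_split big1 // => j _ /=.
under [X in _ + X]eq_bigr => i _ do rewrite linearZ.
rewrite -!scaler_sumr -scalerDr -big_split /=.
rewrite (dual_invariant (F := fun a => f (consf a (omit j x)))) ?scaler0 //.
exact: alternating_linear.
Qed.

End Homotopy.

(** * Conjugation of cochains by an automorphism *)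

Section Twist.
Variables (K : fieldType) (g : vectType K) (br : {bilinear g -> g -> g}).

Definition twist (h h' : g -> g) n (f : ('I_n -> g) -> g) : ('I_n -> g) -> g :=
  fun x => h' (f (h \o x)).

Lemma twistK h h' n : cancel h h' -> cancel h' h ->
  cancel (@twist h h' n) (@twist h' h n).
Proof.
move=> hK h'K f; apply/funext => x; rewrite /twist h'K; congr f.
by apply/funext => i /=; rewrite h'K.
Qed.

Lemma alternating_twist (h h' : {linear g -> g}) n (f : ('I_n -> g) -> g) :
  alternating f -> alternating (twist h h' f).
Proof. by move=> fA; apply/alternating_comp/alternating_precomp. Qed.

Variables (h h' : {linear g -> g}).
Hypothesis hM : forall x y, h (br x y) = br (h x) (h y).
Hypothesis h'M : forall x y, h' (br x y) = br (h' x) (h' y).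
Hypothesis hK : cancel h h'.

Lemma twist_ce1 n (f : ('I_n.-1 -> g) -> g) :
  twist h h' (ce1 br f) = ce1 br (twist h h' f).
Proof.
apply/funext => x; rewrite /twist /ce1 linear_ssum.
apply: eq_bigr => j _ /=.
by rewrite h'M hK.
Qed.

Lemma twist_ce2 n (f : ('I_n.-1 -> g) -> g) :
  twist h h' (ce2 br f) = ce2 br (twist h h' f).
Proof.
apply/funext => x; rewrite /twist /ce2 linear_psum.
case: n f x => [|[|n]] f x; rewrite ?psum0 ?psum1 //.
apply: eq_bigr => j _; apply: eq_bigr => i _ /=.
by rewrite comp_consf // hM.
Qed.

Lemma twist_ce n (f : ('I_n.-1 -> g) -> g) :
  twist h h' (ce br f) = ce br (twist h h' f).
Proof.
rewrite /ce -twist_ce1 -twist_ce2.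
by apply/funext => x; rewrite subfctE /twist subfctE linearB.
Qed.

End Twist.

(** * The alpha-type complex as a cone *)

Section IterLinear.
Variables (K : fieldType) (g : vectType K) (h : {linear g -> g}).

Lemma iter_linear m : linear (iter m h).
Proof. by elim: m => [//|m IHm] k u v; rewrite !iterS IHm linearP. Qed.

HB.instance Definition _ m := GRing.isLinear.Build K g g _ (iter m h) (iter_linear m).

End IterLinear.

Section NormalForm.
Variables (K : fieldType) (g : vectType K) (nu : {bilinear g -> g -> g}).
Variables (alpha beta : 'End(g)) (br : {bilinear g -> g -> g}).
Hypothesis alphaK : cancel alpha beta.
Hypothesis betaK : cancel beta alpha.
Hypothesis nuE : forall x y, nu x y = alpha (br x y).
Hypothesis alphaM : forall x y, alpha (br x y) = br (alpha x) (alpha y).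
Hypothesis brJ : forall x y z, br x (br y z) = br (br x y) z + br y (br x z).

Local Notation tau := (twist alpha beta).

Lemma betaM x y : beta (br x y) = br (beta x) (beta y).
Proof. by rewrite -{1}[x]betaK -{1}[y]betaK -alphaM alphaK. Qed.

Lemma iter_alphaM m x y :
  iter m alpha (br x y) = br (iter m alpha x) (iter m alpha y).
Proof. by elim: m x y => [//|m IHm] x y; rewrite !iterS IHm alphaM. Qed.

(** The power of [alpha] comes out since [nu] is [alpha] after [br] and [alpha] is an automorphism
    of [br]. In the second sum [u] is evaluated on [alpha] of all its arguments, which is [alpha] of
    [tau u]. *)
Lemma d_bracketE m n (u : ('I_n.-1 -> g) -> g) x :
  d_bracket nu alpha m (fun z => iter m alpha (u z)) x =
  iter m.+1 alpha (ce1 br u x - ce2 br (tau u) x).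
Proof.
rewrite linearB /= -iterS; congr (_ - _).
  rewrite linear_ssum; apply: eq_bigr => j _; congr (_ *: _).
  by rewrite /= nuE -iter_alphaM.
rewrite /= !linear_psum.
case: n u x => [|[|n]] u x; first by rewrite big_ord0 psum0.
  by rewrite psum1 big_ord_recl big_ord0 addr0 big_ord0.
apply: eq_bigr => j _; apply: eq_bigr => i _.
congr (_ *: _); rewrite /twist /= -iterS iterSr betaK comp_consf //.
by rewrite nuE.
Qed.

Lemma d_nualphaE m n (u : ('I_n -> g) -> g) x :
  d_nualpha alpha (fun z => iter m alpha (u z)) x =
  iter m.+1 alpha (u x - tau u x).
Proof.
rewrite /d_nualpha linearB /=; congr (_ - _).
by rewrite /twist -iterS iterSr betaK.
Qed.

Lemma d_alphanuE n (h : ('I_n -> g) -> g) x : h \in @Alt K g n ->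
  @d_alphanu K g nu alpha n.+1 (fun z => iter n alpha (h z)) x =
  iter n.+1 alpha (@curv _ _ br n.+2 h x).
Proof.
rewrite /curv linear_psum; case: n h x => [|n] h x hA.
  apply: eq_bigr => j _; apply: eq_bigr => i _.
  (* In degree 0 the truncated exponent gives a wrong power of [alpha], harmless because [h] is
     zero. *)
  by move/Alt0P: hA => ->; rewrite !linear0.
apply: eq_bigr => j _; apply: eq_bigr => i _; congr (_ *: _).
by rewrite !nuE -iter_alphaM -iterS -iter_alphaM.
Qed.

(* In the coordinates [f], [h] the coboundary is that of the mapping cone of
   [1 - tau] on the Chevalley-Eilenberg complex, up to rescaling by [tau]. *)
Definition cone_cochain n (f : ('I_n -> g) -> g) (h : ('I_n.-1 -> g) -> g) :
    precochain g n :=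
  (fun x => iter n.-1 alpha (f x + ce1 br h x), fun z => iter n.-1 alpha (h z)).

(** In the first entry, [ce1 (ce1 h)] cancels the [curv h] of [d_alphanu], and [ce1_ce2] at [tau h]
    rewrites [ce2 (ce1 (tau h))]. In the second, the [ce1 h] inside [u] cancels that of
    [d_alphaalpha]. *)
Lemma coboundary_cone n (f : ('I_n.+1 -> g) -> g) (h : ('I_n -> g) -> g) :
  h \in @Alt K g n ->
  coboundary nu alpha (@cone_cochain n.+1 f h) =
  @cone_cochain n.+2 (tau (@ce _ _ br n.+2 f))
                     (f - tau f - tau (@ce _ _ br n.+1 h)).
Proof.
move=> hA; have hC := Alt_alternating hA.
have tP m (u v : ('I_m -> g) -> g) : tau (u + v) = tau u + tau v.
  by apply/funext => z; apply: (linearD beta).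
have tN m (u : ('I_m -> g) -> g) : tau (- u) = - tau u.
  by apply/funext => z; apply: (linearN beta).
have t1 m (u : ('I_m.-1 -> g) -> g) : tau (ce1 br u) = ce1 br (tau u) := twist_ce1 betaM alphaK u.
have t2 m (u : ('I_m.-1 -> g) -> g) : tau (ce2 br u) = ce2 br (tau u) :=
  twist_ce2 beta alphaM u.
pose u := f + @ce1 _ _ br n.+1 h.
congr pair; apply/funext => x.
  rewrite subfctE d_alphanuE // /d_nunu d_bracketE -linearB /=.
  congr (alpha (iter _ _ _)).
  suff /(congr1 (fun F => F x)) : @ce1 _ _ br n.+2 u - @ce2 _ _ br n.+2 (tau u)
      - @curv _ _ br n.+2 h =
      tau (@ce _ _ br n.+2 f) +
      @ce1 _ _ br n.+2 (f - tau f - tau (@ce _ _ br n.+1 h)) by [].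
  have E := @ce1_ce2 _ _ br n.+2 (tau h) (alternating_twist alpha beta hC).
  rewrite /ce /u !tP !tN !t1 !t2 !linearD !linearN /= -!(@ce1_ce1 _ _ br brJ n.+2).
  move: E; rewrite -(@ce1_ce1 _ _ br brJ n.+2) !linearN /= => <-.
  rewrite opprK !opprD.
  rewrite [LHS](AC ((2*2)*1) ((2*5)*(1*(3*4)))) /= subrr add0r.
  by rewrite [RHS](AC (2*(2*(2*1))) ((1*4)*(7*5)*(3*(2*6)))) /= !subrr !add0r.
rewrite subfctE d_nualphaE /d_alphaalpha d_bracketE -linearB /=.
congr (alpha (iter _ _ _)).
suff /(congr1 (fun F => F x)) : u - tau u - (@ce1 _ _ br n.+1 h - @ce2 _ _ br n.+1 (tau h)) =
    f - tau f - tau (@ce _ _ br n.+1 h) by [].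
rewrite /ce /u !tP !tN !t1 !t2.
rewrite !(opprB, opprD).
by rewrite [LHS](AC ((2*2)*2) ((2*6)*((1*3)*(5*4)))) /= subrr add0r.
Qed.

Lemma iter_alphaK m : cancel (iter m alpha) (iter m beta).
Proof. by elim: m => [//|m IHm] x; rewrite iterSr iterS alphaK IHm. Qed.

Lemma iter_betaK m : cancel (iter m beta) (iter m alpha).
Proof. by elim: m => [//|m IHm] x; rewrite iterSr iterS betaK IHm. Qed.

Definition cone_snd n (c : precochain g n) : ('I_n.-1 -> g) -> g :=
  fun z => iter n.-1 beta (c.2 z).

Definition cone_fst n (c : precochain g n) : ('I_n -> g) -> g :=
  fun x => iter n.-1 beta (c.1 x) - ce1 br (cone_snd c) x.

Lemma cone_cochain_coord n (c : precochain g n) :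
  cone_cochain (cone_fst c) (cone_snd c) = c.
Proof.
case: c => f h; congr pair; apply/funext => x.
  by rewrite /cone_fst subrK iter_betaK.
by rewrite /cone_snd iter_betaK.
Qed.

Lemma cone_sndE n (f : ('I_n -> g) -> g) (h : ('I_n.-1 -> g) -> g) :
  cone_snd (cone_cochain f h) = h.
Proof. by apply/funext => x; rewrite /cone_snd iter_alphaK. Qed.

Lemma cone_fstE n (f : ('I_n -> g) -> g) (h : ('I_n.-1 -> g) -> g) :
  cone_fst (cone_cochain f h) = f.
Proof. by apply/funext => x; rewrite /cone_fst cone_sndE iter_alphaK addrK. Qed.

Lemma cone_fst_linear n : linear (@cone_fst n).
Proof.
move=> k c c'; apply/funext => x.
rewrite -[RHS]/(k *: cone_fst c x + cone_fst c' x) /cone_fst /ce1.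
rewrite (eq_ssum _ (F' := fun b z => k *: br b (cone_snd c z) +
    br b (cone_snd c' z))); last first.
  by move=> b z; rewrite /cone_snd !linearP.
by rewrite ssumP linearP /= scalerBr opprD addrACA.
Qed.

Lemma cone_snd_linear n : linear (@cone_snd n).
Proof. by move=> k c c'; apply/funext => x; rewrite /cone_snd linearP. Qed.

HB.instance Definition _ n :=
  GRing.isLinear.Build K _ _ _ (@cone_fst n) (@cone_fst_linear n).
HB.instance Definition _ n :=
  GRing.isLinear.Build K _ _ _ (@cone_snd n) (@cone_snd_linear n).

Lemma cone_cochain_in n (f : ('I_n.+1 -> g) -> g) (h : ('I_n -> g) -> g) :
  alternating f -> h \in @Alt K g n -> @cone_cochain n.+1 f h \in cochains g n.+1.
Proof.
move=> fA hA; have hC := Alt_alternating hA; apply/andP; split.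
  apply/AltP/(alternating_comp (iter n alpha)).
  have := alternatingP 1 fA (alternating_ce1 br (n := n.+1) hC).
  by rewrite scale1r.
rewrite /cone_cochain /=.
move: n h hA hC {f fA} => [|n] h hA hC.
  by move/Alt0P: hA => ->; rewrite rpred0.
exact/AltP/(alternating_comp (iter n.+1 alpha)).
Qed.

Lemma cone_fst_alternating n (c : precochain g n.+1) :
  c \in cochains g n.+1 -> alternating (cone_fst c).
Proof.
case/andP=> /AltP c1 /Alt_alternating c2.
have h2 : alternating (cone_snd c) by apply: (alternating_comp (iter n beta)).
have := alternatingP (-1) (alternating_ce1 br (n := n.+1) h2)
  (alternating_comp (iter n beta) c1).
by apply: alternating_ext => x; rewrite -[LHS]/(-1 *: _ + _) scaleN1r addrC.
Qed.

Lemma cone_snd_Alt n (c : precochain g n.+1) :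
  c \in cochains g n.+1 -> cone_snd c \in @Alt K g n.
Proof.
case/andP=> _; case: n c => [|n] c.
  by move=> /Alt0P c2; apply/Alt0P/funext => x; rewrite /cone_snd c2.
by move=> /AltP c2; apply/AltP/(alternating_comp (iter n.+1 beta)).
Qed.

(** The coordinates are faithful and [tau] is injective, so the cone formula vanishes entry by
    entry. *)
Lemma cocycle_cone n (c : precochain g n.+1) : c \in cochains g n.+1 ->
  coboundary nu alpha c = 0 <->
  @ce _ _ br n.+2 (cone_fst c) = 0 /\
  cone_fst c - tau (cone_fst c) = tau (@ce _ _ br n.+1 (cone_snd c)).
Proof.
move=> cA; have hA := cone_snd_Alt cA.
rewrite -{1}[c]cone_cochain_coord coboundary_cone //.
set F := tau _; set H := _ - _; split=> [FH0|[f0 h0]].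
  have F0 : F = 0.
    by rewrite -(cone_fstE F H) FH0 linear0.
  have H0 : H = 0 by rewrite -(@cone_sndE n.+2 F H) FH0 linear0.
  split; last by apply/eqP; rewrite -subr_eq0; apply/eqP.
  rewrite -[LHS](twistK alphaK betaK) -/F F0.
  by apply/funext => x; apply: (linear0 alpha).
have -> : H = 0 by rewrite /H h0 subrr.
have -> : F = 0 by rewrite /F f0; apply/funext => x; apply: (linear0 beta).
by rewrite -[RHS](@cone_cochain_coord n.+2) !linear0.
Qed.

End NormalForm.

(** * Cartan's criterion *)

(** Adjoin a root of an irreducible factor, divide by the linear factor and recurse over the larger
    field. *)
Lemma splitting_field (F : fieldType) (p : {poly F}) : p != 0 ->
  exists (L : fieldType) (iota : {rmorphism F -> L}) (s : seq L),
    map_poly iota p %= \prod_(z <- s) ('X - z%:P).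
Proof.
move: {2}_.+1 (ltnSn (size p)) => n.
elim: n => // n IHn in F p * => lbn p0.
have [p1|p_gt1] := leqP (size p) 1.
  exists F, idfun, [::]; rewrite big_nil map_poly_id // -size_poly_eq1.
  by rewrite eqn_leq p1 size_poly_gt0.
(* A nonconstant divisor of least size is irreducible. *)
have [r [r_dv_p irr_r]] : exists r, r %| p /\ irreducible_poly r.
  pose Q m := `[< exists r : {poly F}, [/\ (1 < size r)%N, r %| p & size r = m] >].
  have exQ : exists m, Q m by exists (size p); apply/asboolP; exists p.
  case: (ex_minnP exQ) => m /asboolP[r [r1 rp rm]] min_m.
  exists r; split=> //; split=> // q q1 qr.
  have r0 : r != 0 by rewrite -size_poly_gt0 ltnW.
  have q0 := dvdpN0 qr r0.
  rewrite -dvdp_size_eqp // eqn_leq dvdp_leq //= rm; apply: min_m.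
  apply/asboolP; exists q; split=> //; last exact: dvdp_trans rp.
  by rewrite ltn_neqAle eq_sym q1 size_poly_gt0.
have [L _ [z rz _]] := irredp_FAdjoin irr_r.
have /factor_theorem[q pq] : root (map_poly (in_alg L) p) z.
  rewrite -dvdp_XsubCl (dvdp_trans _ (_ : map_poly (in_alg L) r %| _)) //.
    by rewrite dvdp_XsubCl.
  by rewrite dvdp_map.
have mp0 : map_poly (in_alg L) p != 0 by rewrite map_poly_eq0.
have q0 : q != 0 by apply: contraNneq mp0 => q0; rewrite pq q0 mul0r.
have sq : (size q < n)%N.
  have := congr1 (fun u : {poly _} => size u) pq.
  rewrite /= size_map_poly size_Mmonic ?monicXsubC // size_XsubC addn2 /=.
  by move=> sp; move: lbn; rewrite sp.
have [M [iota [s qs]]] := IHn L q sq q0.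
exists M, (iota \o in_alg L), (iota z :: s).
rewrite big_cons map_poly_comp /= pq rmorphM /= rmorphB /= map_polyX map_polyC.
by rewrite mulrC eqp_mull.
Qed.

Lemma int_multiple m (c : 'rV[rat]_m) :
  exists (d : int) (z : 'rV[int]_m),
    d != 0 /\ d%:~R *: c = map_mx intr z.
Proof.
pose d := \prod_i denq (c 0 i).
exists d, (map_mx numq (d%:~R *: c)); split.
  by apply/prodf_neq0 => i _; apply: denq_neq0.
rewrite -map_mx_comp map_mx_id_in // => i j.
rewrite mxE mulrC [d](bigD1 j) //= rmorphM mulrA ord1.
by rewrite -numqE -rmorphM numq_int.
Qed.

Lemma intr_char0 (F : fieldType) : [pchar F] =i pred0 ->
  forall d : int, (d%:~R == 0 :> F) = (d == 0).
Proof.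
move=> /pcharf0P charF; case=> n; first by rewrite -[n%:~R]/(n%:R) charF.
by rewrite NegzE rmorphN /= !oppr_eq0 -[n.+1%:~R]/(n.+1%:R) charF.
Qed.

(* If some [lambda i0] is nonzero, it is separated from 0 by a Q-linear
   functional on the Q-span of the [lambda i]; [z i] is its value at
   [lambda i], up to a common denominator. *)
Lemma integral_functional (F : fieldType) (charF : [pchar F] =i pred0) m
    (lambda : 'I_m -> F) i0 : lambda i0 != 0 ->
  exists z : 'I_m -> int, z i0 != 0 /\
    forall q : 'I_m -> int,
      \sum_i (q i)%:~R * lambda i = 0 -> \sum_i q i * z i = 0.
Proof.
move=> l0; pose Lam : 'cV[F]_m := \col_i lambda i.
pose iR k (Z : 'M[int]_(k, m)) : 'M[rat]_(k, m) := map_mx intr Z.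
(* [Q r] says that some integer relations among the [lambda i] have rank [r]. At the maximal rank,
   the rows of [Z] span all integer relations over the rationals. *)
pose Q r := `[< exists k (Z : 'M[int]_(k, m)),
  map_mx intr Z *m Lam = 0 /\ \rank (iR k Z) = r >].
have exQ : exists r, Q r.
  exists 0; apply/asboolP; exists 0, 0; split; first by rewrite map_mx0 mul0mx.
  by rewrite /iR map_mx0 mxrank0.
have ubQ r : Q r -> (r <= m)%N.
  by move=> /asboolP[k [Z [_ <-]]]; apply: rank_leq_col.
case: (ex_maxnP exQ ubQ) => r /asboolP[k [Z [ZL Zr]]] max_r.
have relZ (q : 'rV[int]_m) : map_mx intr q *m Lam = 0 -> (iR _ q <= iR k Z)%MS.
  move=> qL; pose W := col_mx Z q.
  have : (\rank (iR _ W) <= \rank (iR k Z))%N.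
    rewrite Zr; apply: max_r; apply/asboolP; exists _, W; split=> //.
    by rewrite /W map_col_mx mul_col_mx ZL qL col_mx0.
  rewrite /iR /W map_col_mx => rW.
  have ZW : (iR k Z <= col_mx (iR k Z) (iR _ q))%MS.
    by rewrite -addsmxE addsmxSl.
  have [lW eW] := mxrank_leqif_sup ZW.
  move: eW; rewrite eqn_leq lW rW /= => /esym.
  by rewrite col_mx_sub => /andP[].
pose e : 'rV[rat]_m := delta_mx 0 i0.
(* Otherwise clearing denominators would give [d * lambda i0 = 0]. *)
have eZ : ~~ (e <= iR k Z)%MS.
  apply: contra l0 => /submxP[c ec].
  have [d [z [d0 dz]]] := int_multiple c.
  have : d *: delta_mx 0 i0 = z *m Z :> 'rV[int]_m.
    apply/matrixP => i j; apply: (intr_inj (R := rat)).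
    have : map_mx intr (d *: delta_mx 0 i0) = map_mx intr (z *m Z) :> 'rV[rat]_m.
      by rewrite map_mxZ map_mxM -dz -scalemxAl -ec map_delta_mx.
    by move/matrixP/(_ i j); rewrite ![map_mx _ _ _ _]mxE.
  move=> /(congr1 (fun M => map_mx intr M *m Lam)).
  rewrite map_mxM -mulmxA ZL mulmx0 map_mxZ map_delta_mx -scalemxAl -rowE.
  move=> /matrixP/(_ 0 0); rewrite !mxE => /eqP; rewrite mulf_eq0.
  by rewrite (intr_char0 charF) (negPf d0).
have : e *m cokermx (iR k Z) != 0 by rewrite -submxE.
case/rV0Pn=> j ej.
(* A column of the cokernel matrix is a functional that kills every relation but not the basis
   vector at [i0]; [z] is an integer multiple of it. *)
pose v := (col j (cokermx (iR k Z)))^T.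
have [d [z [d0 dz]]] := int_multiple v.
have zE i : (z 0 i)%:~R = d%:~R * v 0 i :> rat.
  by have /matrixP/(_ 0 i) := dz; rewrite !mxE => ->.
exists (fun i => z 0 i); split=> [|q qL].
  rewrite -(intr_eq0 rat) zE mulf_neq0 ?intr_eq0 //.
  by move: ej; rewrite -rowE !mxE.
have : map_mx intr (\row_i q i) *m Lam = 0.
  apply/matrixP => i l; rewrite !mxE -[RHS]qL.
  by apply: eq_bigr => t _; rewrite !mxE.
move/relZ => /submxP[c cq].
have : iR _ (\row_i q i) *m cokermx (iR k Z) = 0.
  by rewrite cq -mulmxA mulmx_coker mulmx0.
move=> /matrixP/(_ 0 j); rewrite !mxE => qv.
apply: (intr_inj (R := rat)); rewrite rmorph_sum /= -[RHS](mulr0 d%:~R) -[in RHS]qv.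
rewrite mulr_sumr; apply: eq_bigr => i _.
by rewrite rmorphM /= zE !mxE mulrCA.
Qed.

(** * Traces of nilpotents and idempotents; spectral projections *)

Section SpectralProjections.
Variables (F : fieldType).

(** As [M^k = 0], the matrix [X - M] divides the scalar matrix [X^k]; taking determinants, the
    characteristic polynomial divides a power of X. *)
Lemma nilpotent_char_poly n (M : 'M[F]_n.+1) k : M ^+ k = 0 ->
  char_poly M = 'X^(n.+1).
Proof.
move=> Mk; pose P := char_poly_mx M.
have : P * \sum_(i < k) ('X%:M) ^+ (k.-1 - i) * (map_mx polyC M) ^+ i = ('X^k)%:M.
  rewrite -subrXX_comm; last by apply/esym; apply: scalar_mxC.
  by rewrite -!rmorphXn /= Mk rmorph0 subr0.
move=> /(congr1 determinant); rewrite det_mulmx det_scalar -exprM => PX.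
have : char_poly M %| ('X - 0%:P) ^+ (k * n.+1).
  by rewrite subr0 -PX dvdp_mulr.
case/dvdp_exp_XsubCP => j _; rewrite subr0 => Mj.
have := eqp_size Mj; rewrite size_char_poly size_polyXn => -[nj].
apply/eqP; rewrite -eqp_monic ?char_poly_monic ?monicXn //.
by move: Mj; rewrite -nj.
Qed.

Lemma nilpotent_trace n (M : 'M[F]_n.+1) k : M ^+ k = 0 -> \tr M = 0.
Proof.
move=> Mk; apply/eqP; rewrite -oppr_eq0 -char_poly_trace //.
by rewrite (nilpotent_char_poly Mk) coefXn /= ltn_eqF.
Qed.

Lemma idempotent_trace n (P : 'M[F]_n) : P *m P = P -> \tr P = (\rank P)%:R.
Proof.
move=> PP; rewrite -{1}(mulmx_base P) mxtrace_mulC.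
suff -> : row_base P *m col_base P = 1%:M by rewrite mxtrace1.
apply: (row_full_inj (col_base_full P)); apply: (row_free_inj (row_base_free P)).
by rewrite /= mulmx1 mulmxA mulmx_base -mulmxA mulmx_base PP.
Qed.

(** In a Bezout identity [u p_i0 + v q = 1] with [q] the product of the other [p_j], multiply the
    first summand by the inductive partition of 1. *)
Lemma coprime_partition (I : eqType) (p : I -> {poly F}) i0 (s : seq I) :
  uniq (i0 :: s) ->
  {in i0 :: s &, forall i j, i != j -> coprimep (p i) (p j)} ->
  exists c : I -> {poly F},
    \sum_(i <- i0 :: s) c i * \prod_(j <- i0 :: s | j != i) p j = 1.
Proof.
elim: s i0 => [|i1 s IHs] i0 us co.
  by exists (fun=> 1); rewrite big_seq1 big_cons eqxx /= big_nil mulr1.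
have [c c1] := IHs i1 (proj2 (andP us)) (fun i j si sj => co i j
  (mem_behead (s := i0 :: _) si) (mem_behead (s := i0 :: _) sj)).
set r := i1 :: s in us co c c1 *.
have {us} [i0r ur] : i0 \notin r /\ uniq r by apply/andP.
have : coprimep (p i0) (\prod_(j <- r) p j).
  rewrite big_seq; elim/big_rec: _ => [|j q jr cq]; first exact: coprimep1.
  rewrite coprimepMr cq andbT; apply: co; rewrite ?mem_head // ?(mem_behead (s := i0 :: r)) //.
  by apply: contraTneq jr => <-.
case/Bezout_eq1_coprimepP => -[u v] /= uv.
exists (fun i => if i == i0 then v else u * c i).
rewrite big_cons eqxx big_cons eqxx /= -[RHS]uv addrC.
have ne i : i \in r -> (i == i0) = false by move=> ir; apply: contraNF i0r => /eqP <-.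
congr (_ + v * _).
  transitivity (u * p i0 * \sum_(i <- r) c i * \prod_(j <- r | j != i) p j);
    last by rewrite c1 mulr1.
  rewrite mulr_sumr !big_seq; apply: eq_bigr => i ir.
  by rewrite ne // big_cons eq_sym ne //=; rewrite mulrACA.
rewrite big_seq_cond [RHS]big_seq; apply: eq_bigl => j.
by case: (boolP (j \in r)) => //= jr; rewrite ne.
Qed.

(** The projections are the values at [A] of the terms of a partition of 1; the products that must
    vanish are divisible by the characteristic polynomial. *)
Lemma spectral_projections n (A : 'M[F]_n.+1) m (lambda : 'I_m -> F) N :
  injective lambda -> char_poly A %| \prod_i ('X - (lambda i)%:P) ^+ N ->
  exists pi : 'I_m -> 'M[F]_n.+1,
    [/\ \sum_i pi i = 1, forall i j, i != j -> pi i * pi j = 0,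
        forall i, GRing.comm A (pi i)
      & forall i, (A - (lambda i)%:M) ^+ N * pi i = 0].
Proof.
move=> inj dvd; pose p i := ('X - (lambda i)%:P) ^+ N.
have A0 (q : {poly F}) : \prod_i p i %| q -> horner_mx A q = 0.
  move=> pq; have /dvdpP[r ->] := dvdp_trans dvd pq.
  by rewrite rmorphM /= Cayley_Hamilton mulr0.
have [c c1] : exists c : 'I_m -> {poly F},
    \sum_i c i * \prod_(j | j != i) p j = 1.
  (* An empty family would make the characteristic polynomial, of positive degree, divide 1. *)
  have := index_enum_uniq 'I_m; case E : (index_enum 'I_m) => [|i0 s] us.
    have := size_char_poly A; have := dvdp_leq _ dvd.
    by rewrite /= E big_nil oner_eq0 size_poly1 => /(_ isT) + sA; rewrite sA.
  apply: coprime_partition us _ => i j _ _ ij.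
  rewrite coprimep_expl // coprimep_expr // coprimep_XsubC2 // subr_eq0.
  by rewrite eq_sym (inj_eq inj).
pose q i := c i * \prod_(j | j != i) p j.
exists (fun i => horner_mx A (q i)); split.
- by rewrite -(rmorph_sum (horner_mx A)) c1 rmorph1.
- move=> i j ij; rewrite -(rmorphM (horner_mx A)) /= A0 //.
  rewrite /q mulrACA dvdp_mull // [X in X %| _](bigD1 j) //= dvdp_mul //.
  by rewrite (bigD1 j) 1?eq_sym //= dvdp_mulr.
- by move=> i; apply/esym/comm_horner_mx.
- move=> i; have -> : (A - (lambda i)%:M) ^+ N = horner_mx A (p i).
    by rewrite rmorphXn rmorphB /= horner_mx_X horner_mx_C.
  by rewrite -(rmorphM (horner_mx A)) /= A0 // /q mulrCA dvdp_mull // [X in X %| _](bigD1 i).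
Qed.

Lemma eigen_disjoint m n (W : 'M[F]_(m, n.+1)) (A : 'M[F]_n.+1) a b N M :
  W *m (A - a%:M) ^+ N = 0 -> W *m (A - b%:M) ^+ M = 0 -> a != b -> W = 0.
Proof.
move=> Wa Wb ab.
have : coprimep (('X - a%:P) ^+ N) (('X - b%:P) ^+ M).
  by rewrite coprimep_expl // coprimep_expr // coprimep_XsubC2 // subr_eq0 eq_sym.
case/Bezout_eq1_coprimepP => -[u v] /=; rewrite mulrC [v * _]mulrC.
move=> /(congr1 (horner_mx A)).
rewrite rmorphD !rmorphM rmorph1 /= !rmorphXn !rmorphB /= !horner_mx_X !horner_mx_C.
move=> /(congr1 (mulmx W)); rewrite mulmxDr !mulmxA Wa Wb !mul0mx addr0.
by rewrite (mulmx1 W).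
Qed.

End SpectralProjections.

(** * Vanishing of the eigenvalues of [ad x] when the Killing form is zero *)

Section KillingZero.
Variables (F : fieldType) (n : nat).
Variable ad : {linear 'rV[F]_n.+1 -> 'M[F]_n.+1}.
Hypothesis charF : [pchar F] =i pred0.
(** Matrices act on row vectors, so [v *m ad u] stands for [[u, v]] and products appear in reverse
    order. *)
Hypothesis adJ : forall u v, ad (v *m ad u) = ad v *m ad u - ad u *m ad v.
Hypothesis killing0 : forall u v, \tr (ad u *m ad v) = 0.

(** Cyclicity turns the trace of a commutator against [Y] into that of [ad b] against the commutator
    of [ad a] and [Y], which is [ad (a *m Y)]: a value of the Killing form. *)
Lemma derivation_trace (Y : 'M[F]_n.+1) a b :
  (forall u, ad u *m Y = ad (u *m Y) + Y *m ad u) ->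
  \tr (ad (b *m ad a) *m Y) = 0.
Proof.
move=> dY; rewrite adJ mulmxBl raddfB /= -mulmxA dY mulmxDr.
rewrite raddfD /= killing0 add0r.
by rewrite mulmxA [X in _ - X]mxtrace_mulC !mulmxA [X in _ - X]mxtrace_mulC mulmxA subrr.
Qed.

(** By the Leibniz rule, [ad x - (a + b)] on a bracket applies [ad x - a] to one factor or
    [ad x - b] to the other; the induction is on a bound for [p + q]. *)
Lemma ad_eigen_add k (W : 'M[F]_(k, n.+1)) (u x : 'rV[F]_n.+1) a b p q :
  W *m (ad x - a%:M) ^+ p = 0 -> u *m (ad x - b%:M) ^+ q = 0 ->
  W *m ad u *m (ad x - (a + b)%:M) ^+ (p + q) = 0.
Proof.
move: {2}(p + q)%N (leqnn (p + q)) => r.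
elim: r p q W u => [|r IHr] [|p] [|q] W u //; rewrite ?expr0 ?(mulmx1 W) ?(mulmx1 u).
- by move=> _ -> _; rewrite !mul0mx.
- by move=> _ -> _; rewrite !mul0mx.
- by move=> _ -> _; rewrite !mul0mx.
- by move=> _ _ ->; rewrite linear0 mulmx0 mul0mx.
move=> pq Wp uq; rewrite addnS exprS.
rewrite -[_ * _]/(_ *m _) mulmxA.
have -> : W *m ad u *m (ad x - (a + b)%:M) =
    (W *m (ad x - a%:M)) *m ad u + W *m ad (u *m (ad x - b%:M)).
  rewrite !mulmxBr !mulmxBl !mul_mx_scalar linearB linearZ /= adJ.
  rewrite mulmxBr mulmxBr linearZ /= -!mulmxA -scalemxAl -scalemxAr scalerDl.
  rewrite !scalerN.
  by rewrite [RHS](AC (2*(2*1)) ((3*(2*5))*(1*4))) /= subrr addr0.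
have pq' : (p + q.+1 <= r)%N by move: pq; rewrite addSn ltnS.
have H1 : W *m (ad x - a%:M) *m ad u *m (ad x - (a + b)%:M) ^+ (p.+1 + q) = 0.
  rewrite addSnnS IHr // -mulmxA.
  by rewrite -[_ *m _ ^+ p]/(_ * _) -exprS.
have H2 : W *m ad (u *m (ad x - b%:M)) *m (ad x - (a + b)%:M) ^+ (p.+1 + q) = 0.
  rewrite IHr ?addSnnS // -mulmxA.
  by rewrite -[_ *m _ ^+ q]/(_ * _) -exprS.
by rewrite mulmxDl H1 H2 addr0.
Qed.

Lemma prod_XsubC_dvd (s : seq F) : exists N,
  \prod_(z <- s) ('X - z%:P) %|
  \prod_(i < size (undup s)) ('X - ((undup s)`_i)%:P) ^+ N.
Proof.
exists (size s); rewrite prodrXl.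
have <- : \prod_(z <- undup s) ('X - z%:P) =
    \prod_(i < size (undup s)) ('X - ((undup s)`_i)%:P).
  by rewrite (big_nth 0) big_mkord.
have : {in s, forall z, 'X - z%:P %| \prod_(z <- undup s) ('X - z%:P)}.
  by move=> z zs; rewrite dvdp_XsubCl root_prod_XsubC mem_undup.
move: (\prod_(z <- undup s) _) => P.
elim: s => [|z s IHs] sP; first by rewrite big_nil dvd1p.
rewrite big_cons exprS dvdp_mul ?sP ?mem_head // IHs // => y ys.
by rewrite sP // inE ys orbT.
Qed.

(** The first premise stands for perfectness, in a form that passes to an extension field when [x]
    is defined over the base. *)
Lemma killing0_eigenvalue x (s : seq F) :
  (forall Y : 'M[F]_n.+1, (forall a b, \tr (ad (b *m ad a) *m Y) = 0) ->
     \tr (ad x *m Y) = 0) ->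
  char_poly (ad x) %= \prod_(z <- s) ('X - z%:P) -> {in s, forall z, z = 0}.
Proof.
move=> perf chs z0 z0s; apply/eqP; apply/negPn/negP => z0n.
pose A := ad x; pose m := size (undup s).
pose lambda (i : 'I_m) := (undup s)`_i.
have inj : injective lambda.
  move=> i j /eqP; rewrite nth_uniq ?undup_uniq // => /eqP; exact: val_inj.
have [N dvd] := prod_XsubC_dvd s.
have [pi [pi1 pi0 piA piN]] : exists pi : 'I_m -> 'M[F]_n.+1,
    [/\ \sum_i pi i = 1, forall i j, i != j -> pi i * pi j = 0,
        forall i, GRing.comm A (pi i)
      & forall i, (A - (lambda i)%:M) ^+ N * pi i = 0].
  by apply: spectral_projections => //; rewrite (eqp_dvdl _ chs).
have pii i : pi i * pi i = pi i.
  rewrite -{3}[pi i]mulr1 -pi1 mulr_sumr (bigD1 i) //= big1 ?addr0 // => j ji.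
  by rewrite pi0 // eq_sym.
have [i0 li0] : exists i0, lambda i0 = z0.
  have z0u : z0 \in undup s by rewrite mem_undup.
  have lt : (index z0 (undup s) < m)%N by rewrite index_mem.
  by exists (Ordinal lt); rewrite /lambda /= nth_index.
have [z [zi0 zrel]] := integral_functional charF (lambda := lambda) (i0 := i0)
   (ltac:(by rewrite li0)).
have piC c M i : (A - c%:M) ^+ M *m pi i = pi i *m (A - c%:M) ^+ M.
  apply/esym/commrX/commrB; first exact/commr_sym.
  exact: scalar_mxC.
have piN' i : pi i *m (A - (lambda i)%:M) ^+ N = 0.
  by rewrite -piC; apply: piN.
pose v i : F := (z i)%:~R.
have vD i j k : lambda k = lambda i + lambda j -> v k = v i + v j.
  (* [q] encodes the relation [lambda k - lambda i - lambda j = 0]. *)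
  move=> lk; pose q t : int := (t == k)%:R - (t == i)%:R - (t == j)%:R.
  have sumq (R : pzRingType) (f : 'I_m -> R) :
      \sum_t (q t)%:~R * f t = f k - f i - f j.
    have one l : \sum_t (t == l)%:R * f t = f l.
      rewrite (bigD1 l) //= eqxx mul1r big1 ?addr0 // => t /negPf ->.
      by rewrite mul0r.
    rewrite -[in RHS](one k) -[in RHS](one i) -[in RHS](one j) -!sumrB.
    apply: eq_bigr => t _; rewrite /q !rmorphB /= !mulrBl.
    by rewrite !(natrE, rmorph_nat).
  have := zrel q; rewrite sumq lk -addrA -opprD subrr => /(_ erefl).
  have := sumq _ z => /[swap] E.
  under eq_bigr => t _ do rewrite intz.
  rewrite E => /esym/eqP; rewrite -addrA -opprD subr_eq0 => /eqP zk.
  by rewrite /v zk rmorphD.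
pose Y := \sum_i v i *: pi i.
(* [Z u i j] brackets the i-th component of [u] with the j-th component of the argument. It takes
   values in the generalised eigenspace of [lambda i + lambda j], where [Y] is the scalar
   [v i + v j]; it is zero if that sum is not an eigenvalue. *)
pose Z u i j := pi j *m ad (u *m pi i).
have ZY u i j : Z u i j *m Y = (v i + v j) *: Z u i j.
  have Znil : Z u i j *m (A - (lambda j + lambda i)%:M) ^+ (N + N) = 0.
    by apply: ad_eigen_add; rewrite ?piN' // -mulmxA piN' mulmx0.
  rewrite /Y mulmx_sumr -[in RHS](mulmx1 (Z u i j)).
  rewrite -[1%:M]/(1 : 'M_n.+1) -pi1 mulmx_sumr scaler_sumr; apply: eq_bigr => k _.
  rewrite -scalemxAr.
  have [lk|lk] := eqVneq (lambda k) (lambda i + lambda j).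
    by rewrite (vD _ _ _ lk).
  suff -> : Z u i j *m pi k = 0 by rewrite !scaler0.
  apply: (eigen_disjoint (A := A) (a := lambda k) (b := lambda j + lambda i) (N := N) (M := N + N)).
  - by rewrite -mulmxA piN' mulmx0.
  - by rewrite -mulmxA -piC mulmxA Znil mul0mx.
  - by rewrite addrC.
have adZ u : \sum_i \sum_j Z u i j = ad u.
  have E i : \sum_j Z u i j = ad (u *m pi i).
    by rewrite /Z -mulmx_suml pi1; apply: mul1mx.
  under eq_bigr => i _ do rewrite E.
  by rewrite -linear_sum -mulmx_sumr pi1 [u *m _]mulmx1.
have dY u : ad u *m Y = ad (u *m Y) + Y *m ad u.
  have -> : ad (u *m Y) = \sum_i \sum_j v i *: Z u i j.
    rewrite /Y mulmx_sumr linear_sum; apply: eq_bigr => i _.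
    rewrite -scalemxAr linearZ -scaler_sumr /Z -mulmx_suml pi1 /=.
    by congr (_ *: _); rewrite [1 *m _]mul1mx.
  have -> : Y *m ad u = \sum_i \sum_j v j *: Z u i j.
    rewrite -adZ mulmx_sumr; apply: eq_bigr => i _.
    have -> : \sum_j Z u i j = ad (u *m pi i).
      by rewrite /Z -mulmx_suml pi1; apply: mul1mx.
    by rewrite /Y mulmx_suml; apply: eq_bigr => j _; rewrite -scalemxAl.
  rewrite -adZ mulmx_suml -big_split; apply: eq_bigr => i _ /=.
  rewrite mulmx_suml -big_split; apply: eq_bigr => j _ /=.
  by rewrite ZY scalerDl.
have trY := perf _ (fun a b => derivation_trace a b dY).
(* On the image of [pi i], [A] is [lambda i] plus a nilpotent. *)
have trE i : \tr (A *m pi i) = lambda i * (\rank (pi i))%:R.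
  have -> : A *m pi i = (A - (lambda i)%:M) *m pi i + lambda i *: pi i.
    by rewrite mulmxBl mul_scalar_mx subrK.
  rewrite raddfD /= mxtraceZ (idempotent_trace (pii i)).
  rewrite (nilpotent_trace (k := N.+1)) ?add0r //.
  rewrite exprMn_comm; last by have := piC (lambda i) 1 i; rewrite expr1.
  by rewrite exprS [pi i ^+ _]exprS !mulrA -[_ * _ * pi i]mulrA piN mulr0 mul0r.
(* With the ranks in the coefficients, the functional yields a vanishing sum of the nonnegative
   integers [rank_i z_i^2]. *)
pose q i : int := z i * (\rank (pi i))%:Z.
have : \sum_i (q i)%:~R * lambda i = 0.
  rewrite -[RHS]trY /Y mulmx_sumr raddf_sum; apply: eq_bigr => i _ /=.
  by rewrite -scalemxAr mxtraceZ trE rmorphM /= /v mulrA mulrAC.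
move/zrel => /eqP; rewrite psumr_eq0 => [/allP/(_ i0)|i _]; last first.
  by rewrite /q mulrAC mulr_ge0 // -expr2 sqr_ge0.
rewrite mem_index_enum => /(_ isT) /=.
rewrite /q !mulf_eq0 (negPf zi0) /= orbF => /eqP [] /eqP.
rewrite mxrank_eq0 => /eqP pii0.
(* Since [pi i0 = 0], every component of an eigenvector for [z0] vanishes, a contradiction. *)
have : eigenvalue A z0.
  by rewrite eigenvalue_root_char (eqp_root chs) root_prod_XsubC.
case/eigenvalueP=> w wA; apply/negP; rewrite negbK.
rewrite -[w]mulmx1 -[1%:M]/(1 : 'M_n.+1) -pi1 mulmx_sumr big1 // => j _.
have [->|ji] := eqVneq j i0; first by rewrite pii0 mulmx0.
apply: (eigen_disjoint (A := A) (a := lambda j) (b := z0) (N := N) (M := 1)).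
- by rewrite -mulmxA piN' mulmx0.
- have := piC z0 1 j; rewrite !expr1 -mulmxA => <-.
  by rewrite mulmxA mulmxBr wA mul_mx_scalar subrr mul0mx.
- by rewrite -li0 (inj_eq inj).
Qed.
End KillingZero.

Lemma eq_linear_rV (F : fieldType) m (V : lmodType F) (f h : 'rV[F]_m -> V) :
  linear f -> linear h -> (forall i, f (delta_mx 0 i) = h (delta_mx 0 i)) ->
  f =1 h.
Proof.
move=> fL hL fh u.
pose f' : {linear 'rV[F]_m -> V} := HB.pack f (GRing.isLinear.Build F _ _ _ f fL).
pose h' : {linear 'rV[F]_m -> V} := HB.pack h (GRing.isLinear.Build F _ _ _ h hL).
rewrite -[f u]/(f' u) -[h u]/(h' u) (row_sum_delta u) !linear_sum.
by apply: eq_bigr => i _; rewrite !linearZ /= fh.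
Qed.

(** * Descent from a splitting field to the base field *)

Section KillingZeroNilpotent.
Variables (K : fieldType) (n : nat).
Variable ad : {linear 'rV[K]_n.+1 -> 'M[K]_n.+1}.
Hypothesis charK : [pchar K] =i pred0.
Hypothesis adJ : forall u v, ad (v *m ad u) = ad v *m ad u - ad u *m ad v.
Hypothesis killing0 : forall u v, \tr (ad u *m ad v) = 0.
Hypothesis perfect : forall P : 'rV[K]_n.+1 -> Prop, P 0 ->
  (forall k u v, P u -> P v -> P (k *: u + v)) ->
  (forall a b, P (b *m ad a)) -> forall x, P x.

Section Extension.
Variables (L : fieldType) (iota : {rmorphism K -> L}).

Definition ad_ext (u : 'rV[L]_n.+1) : 'M[L]_n.+1 :=
  \sum_i u 0 i *: map_mx iota (ad (delta_mx 0 i)).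

Lemma ad_ext_linear : linear ad_ext.
Proof.
move=> k u v; rewrite /ad_ext scaler_sumr -big_split; apply: eq_bigr => i _ /=.
by rewrite !mxE scalerDl scalerA.
Qed.

HB.instance Definition _ := GRing.isLinear.Build L _ _ _ ad_ext ad_ext_linear.

Lemma ad_ext_map u : ad_ext (map_mx iota u) = map_mx iota (ad u).
Proof.
rewrite {2}(row_sum_delta u) linear_sum raddf_sum; apply: eq_bigr => i _ /=.
by rewrite mxE linearZ /= map_mxZ.
Qed.

Lemma ad_ext_delta i : ad_ext (delta_mx 0 i) = map_mx iota (ad (delta_mx 0 i)).
Proof. by rewrite -ad_ext_map map_delta_mx. Qed.

Lemma ad_extJ u v :
  ad_ext (v *m ad_ext u) = ad_ext v *m ad_ext u - ad_ext u *m ad_ext v.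
Proof.
move: v; apply: eq_linear_rV => [k v w|k v w|j].
- by rewrite mulmxDl -scalemxAl linearP.
- by rewrite linearP mulmxDl mulmxDr -scalemxAl -scalemxAr scalerBr opprD addrACA.
move: u; apply: eq_linear_rV => [k v w|k v w|i].
- by rewrite linearP mulmxDr -scalemxAr linearP.
- by rewrite linearP mulmxDl mulmxDr -scalemxAl -scalemxAr scalerBr opprD addrACA.
by rewrite !ad_ext_delta -(map_delta_mx iota) -!map_mxM ad_ext_map adJ map_mxB.
Qed.

Lemma ad_ext_killing0 u v : \tr (ad_ext u *m ad_ext v) = 0.
Proof.
move: v; apply: (@eq_linear_rV L n.+1 L^o _ (fun=> 0)) => [k v w|k v w|j].
- by rewrite linearP mulmxDr -scalemxAr linearP.
- by rewrite scaler0 addr0.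
move: u; apply: (@eq_linear_rV L n.+1 L^o _ (fun=> 0)) => [k v w|k v w|i].
- by rewrite linearP mulmxDl -scalemxAl linearP.
- by rewrite scaler0 addr0.
by rewrite !ad_ext_delta -map_mxM trace_map_mx killing0 rmorph0.
Qed.

Lemma ad_ext_perfect x (Y : 'M[L]_n.+1) :
  (forall a b, \tr (ad_ext (b *m ad_ext a) *m Y) = 0) ->
  \tr (ad_ext (map_mx iota x) *m Y) = 0.
Proof.
move=> Y0; move: x; apply: perfect => [|k u v u0 v0|a b].
- by rewrite map_mx0 linear0 mul0mx mxtrace0.
- rewrite map_mxD map_mxZ linearP mulmxDl -scalemxAl linearP /=.
  by rewrite [X in _ * X]u0 [X in _ + X]v0 mulr0 addr0.
- by rewrite map_mxM -ad_ext_map Y0.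
Qed.

End Extension.

(** Over a splitting field all roots of the characteristic polynomial are zero, so it is a power of
    X there, hence over [K]; Cayley-Hamilton concludes. *)
Lemma killing0_nilpotent x : ad x ^+ n.+1 = 0.
Proof.
have ch0 : char_poly (ad x) != 0 by rewrite monic_neq0 ?char_poly_monic.
have [L [iota [s chs]]] := splitting_field ch0.
have charL : [pchar L] =i pred0 by move=> p; rewrite (fmorph_pchar iota) charK.
have s0 : {in s, forall z, z = 0}.
  apply: (@killing0_eigenvalue _ _ (@ad_ext L iota) charL (ad_extJ iota)
    (ad_ext_killing0 iota) (map_mx iota x) s) => /=.
    exact: ad_ext_perfect.
  by rewrite ad_ext_map -map_char_poly.
have {}chs : map_poly iota (char_poly (ad x)) = 'X^(size s).
  apply/eqP; rewrite -eqp_monic ?monicXn ?map_monic ?char_poly_monic //.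
  rewrite (eqp_trans chs) // big_seq (eq_bigr (fun=> 'X)).
    by rewrite -big_seq big_const_seq count_predT iter_mulr_1 eqpxx.
  by move=> z /s0 ->; rewrite subr0.
have chX : char_poly (ad x) = 'X^(size s).
  by apply: (map_poly_inj iota); rewrite chs map_polyXn.
have := size_char_poly (ad x); rewrite chX size_polyXn => -[sn].
have := Cayley_Hamilton (ad x).
by rewrite chX sn rmorphXn /= horner_mx_X.
Qed.

End KillingZeroNilpotent.

(** * Engel's theorem *)

Section Engel.
Variables (K : fieldType) (g : vectType K) (br : {bilinear g -> g -> g}).
Hypothesis brxx : forall x, br x x = 0.
Hypothesis brJ : forall x y z, br x (br y z) = br (br x y) z + br y (br x z).
Hypothesis ad_nilpotent : forall x y, exists k, iter k (br x) y = 0.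

Let subalgebra (H : {vspace g}) := forall x y, x \in H -> y \in H -> br x y \in H.
Let stable (H M : {vspace g}) := forall x y, x \in H -> y \in M -> br x y \in M.

Lemma br_anti x y : br x y = - br y x.
Proof.
have := brxx (x + y); rewrite linearDl !linearDr /= !brxx add0r addr0.
by move/eqP; rewrite addr_eq0 => /eqP.
Qed.

(** Engel's theorem for [H] acting on [M / N], by induction on the dimension of [H]. Speaking of
    pairs of subspaces lets the induction apply both to [H / H'] and to [M / N]. *)
Lemma engel_subquotient (H M N : {vspace g}) : subalgebra H ->
  stable H M -> stable H N -> (N <= M)%VS -> ~~ (M <= N)%VS ->
  exists m, [/\ m \in M, m \notin N & forall h, h \in H -> br h m \in N].
Proof.
move: {2}(\dim H).+1 (ltnSn (\dim H)) => d.
elim: d => // d IHd in H M N * => dH Hs HM HN NM MN.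
pose Q k := `[< exists H' : {vspace g},
  [/\ (H' <= H)%VS, subalgebra H', \dim H' = k & (k < \dim H)%N] >].
have [H0|Hn0] := eqVneq (\dim H) 0.
  have /subvPn[m mM mN] := MN; exists m; split=> // h.
  have /eqP -> : H == 0%VS by rewrite -dimv_eq0 H0.
  by rewrite memv0 => /eqP ->; rewrite linear0l mem0v.
have exQ : exists k, Q k.
  exists 0; apply/asboolP; exists 0%VS; split; rewrite ?sub0v ?dimv0 ?lt0n //.
  by move=> x y; rewrite !memv0 => /eqP -> _; rewrite linear0l.
have ubQ k : Q k -> (k <= \dim H)%N by move=> /asboolP[H' [_ _ _ /ltnW]].
case: (ex_maxnP exQ ubQ) => k /asboolP[H' [H'H H's dH' kH]] max_k.
have sub x : x \in H' -> x \in H by move/(subvP H'H).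
have dH'd : (\dim H' < d)%N by rewrite dH' (leq_trans kH).
have HH' : ~~ (H <= H')%VS.
  by apply: contraL kH => /dimvS; rewrite dH' -leqNgt.
(* Acting on [H / H'], the maximal proper subalgebra [H'] is normalised by some [x] outside it;
   maximality then gives [H = H' + <[x]>]. *)
have [x [xH xH' nx]] := IHd H' H H' dH'd H's
  (fun a b aH' bH => Hs a b (sub a aH') bH) H's H'H HH'.
have HE y : y \in H -> exists a h, h \in H' /\ y = h + a *: x.
  pose H2 := (H' + <[x]>)%VS.
  have H2H : (H2 <= H)%VS by rewrite subv_add H'H -memvE.
  have H2s : subalgebra H2.
    move=> _ _ /memv_addP[h hH' [_ /vlineP[a ->] ->]]
                /memv_addP[l lH' [_ /vlineP[b ->] ->]].
    have xl : br x l \in H' by rewrite br_anti rpredN nx.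
    rewrite linearDl !linearDr /= linearZl !linearZr /= linearZl /= brxx !scaler0 addr0.
    apply: (subvP (addvSl _ _)); by rewrite !rpredD ?rpredZ // ?nx // H's.
  have dH2 : (k < \dim H2)%N.
    rewrite -dH' ltn_neqAle dimvS ?addvSl // andbT.
    apply: contra xH' => /eqP dE; have /eqP -> : H' == H2.
      by rewrite eqEdim addvSl dE leqnn.
    by rewrite memvE addvSr.
  have : H2 == H.
    rewrite eqEdim H2H leqNgt; apply/negP => lt2.
    have : Q (\dim H2) by apply/asboolP; exists H2; split.
    by move/max_k; rewrite leqNgt dH2.
  move/eqP => <- /memv_addP[h hH' [_ /vlineP[a ->] ->]].
  by exists a, h.
have [m0 [m0M m0N m0H']] := IHd H' M N dH'd H's
  (fun a b aH' => HM a b (sub a aH')) (fun a b aH' => HN a b (sub a aH')) NM MN.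
(* Vectors of [M] that [H'] sends into [N] form a set stable under [x], because [[H', x]] lies in
   [H']. *)
have inv j : iter j (br x) m0 \in M /\
    forall h, h \in H' -> br h (iter j (br x) m0) \in N.
  elim: j => [|j [jM jN]] //; rewrite iterS; split; first exact: HM.
  move=> h hH'; rewrite brJ rpredD ?jN ?nx //.
  by apply: HN => //; apply: jN.
have exN : exists j, iter j (br x) m0 \in N.
  by have [j j0] := ad_nilpotent x m0; exists j; rewrite j0 mem0v.
(* The last iterate outside [N] is sent into [N] by [x] as well as by [H']. *)
case: (ex_minnP exN) => -[|j]; first by rewrite /= (negPf m0N).
move=> jN min_j; have [jM jH'] := inv j.
exists (iter j (br x) m0); split=> //.
  by apply/negP => /min_j; rewrite ltnn.
move=> _ /HE [a [h [hH' ->]]].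
by rewrite linearDl linearZl /= rpredD ?rpredZ // jH'.
Qed.

Lemma engel_center : fullv != 0%VS :> {vspace g} ->
  exists2 m, m != 0 & forall h, br h m = 0.
Proof.
move=> g0; have [|||||m [_ m0 mC]] := @engel_subquotient fullv fullv 0%VS.
- by move=> x y _ _; rewrite memvf.
- by move=> x y _ _; rewrite memvf.
- by move=> x y _; rewrite !memv0 => /eqP ->; rewrite linear0r.
- by rewrite sub0v.
- by rewrite subv0.
exists m; first by rewrite memv0 in m0.
by move=> h; apply/eqP; rewrite -memv0 mC ?memvf.
Qed.

End Engel.

(** * The Killing form *)

(** Take a subspace of largest dimension contained in [S]; a further vector of [S] would enlarge
    it. *)
Lemma submod_vspace (K : fieldType) (V : vectType K) (S : V -> Prop) :
  S 0 -> (forall k u v, S u -> S v -> S (k *: u + v)) ->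
  exists U : {vspace V}, forall x, x \in U <-> S x.
Proof.
move=> S0 SL.
pose Q k := `[< exists2 U : {vspace V}, \dim U = k & forall x, x \in U -> S x >].
have exQ : exists k, Q k.
  exists 0; apply/asboolP; exists 0%VS; first exact: dimv0.
  by move=> x; rewrite memv0 => /eqP ->.
have ubQ k : Q k -> (k <= \dim {:V})%N.
  by move=> /asboolP[U <- _]; apply/dimvS/subvf.
case: (ex_maxnP exQ ubQ) => k /asboolP[U dU US] max_k.
exists U => x; split=> [|Sx]; first exact: US.
apply/negPn/negP => xU.
have : Q (\dim (<[x]> + U)).
  apply/asboolP; exists (<[x]> + U)%VS => // _ /memv_addP[_ /vlineP[a ->] [u uU ->]].
  exact/SL/US.
move/max_k; apply/negP; rewrite -ltnNge -dU ltn_neqAle dimvS ?addvSr // andbT.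
apply: contra xU => /eqP dE; rewrite (_ : U = (<[x]> + U)%VS).
  by rewrite memvE addvSl.
by apply/eqP; rewrite eqEdim addvSr dE leqnn.
Qed.

Section Killing.
Variables (K : fieldType) (g : vectType K) (br : {bilinear g -> g -> g}).
Hypothesis brxx : forall x, br x x = 0.
Hypothesis brJ : forall x y z, br x (br y z) = br (br x y) z + br y (br x z).

Lemma br_br_anti x y z : br (br x y) z = br z (br y x).
Proof. by rewrite (br_anti brxx) (br_anti brxx x) linearN /= opprK. Qed.

Section Coordinates.
Variables (n : nat) (v : {linear g -> 'rV[K]_n}) (r : {linear 'rV[K]_n -> g}).
Hypotheses (vK : cancel v r) (rK : cancel r v).

Definition mx_of (f : g -> g) : 'M[K]_n := lin1_mx (v \o f \o r).

Lemma mul_mx_of (f : {linear g -> g}) w : w *m mx_of f = v (f (r w)).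
Proof. by rewrite /mx_of mul_rV_lin1. Qed.

Definition adm x : 'M[K]_n := mx_of (br x).

Lemma adm_linear : linear adm.
Proof.
move=> k x y; apply/row_matrixP => i; rewrite !rowE mulmxDr -scalemxAr !mul_mx_of.
by rewrite /= linearPl linearP.
Qed.

HB.instance Definition _ := GRing.isLinear.Build K _ _ _ adm adm_linear.

Lemma adm_br x y : adm (br x y) = adm y *m adm x - adm x *m adm y.
Proof.
apply/row_matrixP => i; rewrite !rowE mulmxBr !mulmxA !mul_mx_of !vK.
by rewrite -linearB /= brJ addrK.
Qed.

Definition killing x y := \tr (adm x *m adm y).

Lemma killingC x y : killing x y = killing y x.
Proof. exact: mxtrace_mulC. Qed.

Lemma killingPl y k x x' :
  killing (k *: x + x') y = k * killing x y + killing x' y.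
Proof. by rewrite /killing linearP mulmxDl -scalemxAl linearP. Qed.

Lemma killing_linear x : linear (killing x : g -> K^o).
Proof. by move=> k y y'; rewrite ![killing x _]killingC killingPl. Qed.

HB.instance Definition _ x :=
  GRing.isLinear.Build K g K^o _ (killing x) (killing_linear x).

Lemma killing0l y : killing 0 y = 0.
Proof. by rewrite killingC linear0. Qed.

Lemma killing_inv x y z : killing (br x y) z = killing x (br y z).
Proof.
rewrite /killing !adm_br mulmxBl mulmxBr !linearB /= -!mulmxA.
by rewrite [\tr (adm y *m _)]mxtrace_mulC -!mulmxA.
Qed.

(** [adm (alpha z)] is conjugate to [adm z] by the matrix of [alpha]. *)
Lemma killing_aut (alpha beta : {linear g -> g}) x y :
  cancel alpha beta -> cancel beta alpha ->
  (forall x y, alpha (br x y) = br (alpha x) (alpha y)) ->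
  killing (alpha x) (alpha y) = killing x y.
Proof.
move=> alphaK betaK alphaM.
have admA z : adm (alpha z) = mx_of beta *m adm z *m mx_of alpha.
  apply/row_matrixP => i; rewrite !rowE !mulmxA !mul_mx_of !vK alphaM.
  by rewrite betaK.
have ab : mx_of alpha *m mx_of beta = 1%:M.
  by apply/row_matrixP => i; rewrite !rowE mulmxA mulmx1 !mul_mx_of vK alphaK rK.
rewrite /killing !admA !mulmxA mxtrace_mulC !mulmxA ab mul1mx.
by rewrite -!mulmxA [mx_of alpha *m _]mulmxA ab mul1mx.
Qed.

Definition gram : 'M[K]_n :=
  \matrix_(i, j) killing (r (delta_mx 0 i)) (r (delta_mx 0 j)).

Hypothesis nondeg : forall x, (forall y, killing x y = 0) -> x = 0.

Lemma delta_expand x : x = \sum_i v x 0 i *: r (delta_mx 0 i).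
Proof.
rewrite -{1}[x]vK {1}(row_sum_delta (v x)) linear_sum.
by apply: eq_bigr => i _; rewrite linearZ.
Qed.

Lemma nondeg_basis x : (forall i, killing x (r (delta_mx 0 i)) = 0) -> x = 0.
Proof.
move=> x0; apply: nondeg => y; rewrite (delta_expand y) linear_sum big1 // => i _.
by rewrite linearZ /= x0 scaler0.
Qed.

Lemma gram_unit : gram \in unitmx.
Proof.
rewrite -row_free_unit -kermx_eq0; apply/rowV0P => w /sub_kermxP wG.
rewrite -[w]rK (_ : r w = 0) ?linear0 //; apply: nondeg_basis => j.
have /matrixP/(_ 0 j) := wG; rewrite !mxE => <-.
rewrite killingC (delta_expand (r w)) rK linear_sum; apply: eq_bigr => i _.
by rewrite linearZ mxE killingC.
Qed.

Let e i := r (delta_mx 0 i).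
Let e' i := \sum_j invmx gram i j *: e j.

Lemma killing_dual i k : killing (e' i) (e k) = (i == k)%:R.
Proof.
have /matrixP/(_ i k) := mulVmx gram_unit; rewrite !mxE => <-.
rewrite killingC linear_sum; apply: eq_bigr => j _.
by rewrite linearZ mxE killingC.
Qed.

Lemma killing_coord z k : v z 0 k = killing z (e' k).
Proof.
rewrite [in RHS](delta_expand z) killingC linear_sum (bigD1 k) //= big1 => [|i ik].
  by rewrite linearZ /= killing_dual eqxx addr0 -[_ *: _]/(_ * _) mulr1.
by rewrite linearZ /= killing_dual eq_sym (negPf ik) scaler0.
Qed.

Lemma killing_expand z : z = \sum_k killing z (e' k) *: e k.
Proof. by rewrite {1}(delta_expand z); apply: eq_bigr => k _; rewrite killing_coord. Qed.

Lemma killing_expand_dual z : z = \sum_k killing z (e k) *: e' k.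
Proof.
apply/eqP; rewrite -subr_eq0; apply/eqP/nondeg_basis => i.
rewrite killingC linearB linear_sum (bigD1 i) //= big1 => [|k ki].
  rewrite linearZ /= [X in _ *: X]killingC killing_dual eqxx addr0 killingC.
  by rewrite -[_ *: _]/(_ * _) mulr1 subrr.
by rewrite linearZ /= [X in _ *: X]killingC killing_dual (negPf ki) scaler0.
Qed.

(** Expand [[e_i, x]] in the [e k] and [[e'_i, x]] in the [e' k]: invariance of the Killing form
    makes the coefficients opposite. *)
Lemma dual_invariant (F : g -> g) x : linear F ->
  \sum_i (br (br (e i) x) (F (e' i)) + br (e i) (F (br (e' i) x))) = 0.
Proof.
move=> FL.
pose F' : {linear g -> g} := HB.pack F (GRing.isLinear.Build K _ _ _ F FL).
rewrite -[F]/(F' : g -> g) big_split /=.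
have -> : \sum_i br (br (e i) x) (F' (e' i)) =
    \sum_i \sum_k killing (br (e i) x) (e' k) *: br (e k) (F' (e' i)).
  apply: eq_bigr => i _; rewrite {1}(killing_expand (br (e i) x)) linear_sumlz.
  by apply: eq_bigr => k _; rewrite linearZl_LR.
have -> : \sum_i br (e i) (F' (br (e' i) x)) =
    \sum_i \sum_k killing (br (e' k) x) (e i) *: br (e k) (F' (e' i)).
  rewrite exchange_big; apply: eq_bigr => i _ /=.
  rewrite {1}(killing_expand_dual (br (e' i) x)) -[F _]/(F' _) !linear_sum.
  by apply: eq_bigr => k _; rewrite !linearZ.
rewrite -big_split big1 // => i _; rewrite -big_split big1 // => k _ /=.
rewrite -scalerDl [X in _ + X]killing_inv (br_anti brxx x) linearN /=.
by rewrite [X in _ - X]killingC subrr scale0r.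
Qed.

(** Paired with [y], the i-th term becomes by invariance the i-th diagonal entry of
    [adm y *m adm x], so the sum is the Killing form of [y] and [x]. *)
Lemma casimir1 x : \sum_i br (e i) (br (e' i) x) = x.
Proof.
apply/eqP; rewrite -subr_eq0; apply/eqP/nondeg => y.
rewrite killingC linearB /= linear_sum; apply/eqP; rewrite subr_eq0; apply/eqP.
rewrite /killing [RHS]/mxtrace; apply: eq_bigr => i _; rewrite -/(killing _ _).
have -> : (adm y *m adm x) i i = v (br x (br y (e i))) 0 i.
  transitivity (row i (adm y *m adm x) 0 i); first by rewrite [RHS]mxE.
  by rewrite rowE mulmxA !mul_mx_of !vK.
rewrite killing_coord -[LHS]/(killing y (br (e i) (br (e' i) x))).
by rewrite [LHS]killingC killing_inv br_br_anti -!killing_inv br_br_anti.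
Qed.

End Coordinates.

Lemma killing0_ad_nilpotent n (v : {linear g -> 'rV[K]_n})
    (r : {linear 'rV[K]_n -> g}) : cancel v r -> cancel r v ->
  [pchar K] =i pred0 ->
  (forall P : g -> Prop, P 0 ->
    (forall k x y, P x -> P y -> P (k *: x + y)) ->
    (forall x y, P (br x y)) -> forall x, P x) ->
  (forall x y, killing v r x y = 0) ->
  forall x y, exists k, iter k (br x) y = 0.
Proof.
move=> vK rK charK perfect kill0 x y; exists n.
have iterE k : v (iter k (br x) y) = iter k (mulmx^~ (adm v r x)) (v y).
  elim: k => // k IHk; rewrite !iterS -IHk mul_mx_of ?vK //.
case: n v r vK rK kill0 iterE => [|n] v r vK rK kill0 iterE.
  by rewrite -[y]vK (thinmx0 (v y)) linear0.
pose ad : {linear 'rV[K]_n.+1 -> 'M[K]_n.+1} := adm v r \o r.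
have adxn : ad (v x) ^+ n.+1 = 0.
  apply: killing0_nilpotent => //.
  - move=> u w; rewrite /ad /= -adm_br ?mul_mx_of ?vK //.
  - by move=> u w; apply: kill0.
  - move=> P P0 PL PB z; rewrite -(rK z); move: (r z).
    apply: (perfect (fun t => P (v t))) => [|k a b Pa Pb|a b].
    + by rewrite linear0.
    + by rewrite linearP; apply: PL.
    + have := PB (v a) (v b); rewrite /ad /= vK mul_mx_of ?vK //.
rewrite -[LHS]vK iterE; rewrite /ad /= vK in adxn.
have iterX k : iter k (mulmx^~ (adm v r x)) (v y) = v y *m adm v r x ^+ k.
  elim: k => [|k IHk]; first by rewrite expr0 mulmx1.
  by rewrite iterS IHk exprSr -[_ * _]/(_ *m _) mulmxA.
by rewrite iterX adxn mulmx0 linear0.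
Qed.

End Killing.

(** * Maps between subquotients *)

Lemma inj_surj_bijective (A B : Type) (f : A -> B) :
  injective f -> (forall b, exists a, f a = b) -> bijective f.
Proof.
move=> f_inj /choice[h fh]; exists h => // a.
by apply: f_inj; rewrite fh.
Qed.

Section SubquotientMaps.
Variables (K : pzRingType) (V W : lmodType K).
Variables (Z B : submodClosed V) (Z' B' : submodClosed W) (F : V -> W).
Hypothesis F_linear : forall k, {in Z &, forall x y, F (k *: x + y) = k *: F x + F y}.
Hypothesis F_in : forall x, x \in Z -> F x \in Z'.

Definition submod_map (z : submod Z) : submod Z' := Submod (F_in (valP z)).

Lemma submod_map_linear : linear submod_map.
Proof.
move=> k x y; apply: val_inj; rewrite -[LHS]/(F (val (k *: x + y))).
by rewrite !linearP (F_linear k (valP x) (valP y)).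
Qed.

HB.instance Definition _ :=
  GRing.isLinear.Build K (submod Z) (submod Z') _ submod_map submod_map_linear.

Definition subquot_map (q : subquot Z B) : subquot Z' B' :=
  cls (submod_map (repr q)).

Hypothesis F_ker : {in Z, forall x, (F x \in B') = (x \in B)}.

Lemma repr_cls (z : submod Z) : val (repr (cls z : subquot Z B) - z) \in B.
Proof. by rewrite -cls_eq /cls reprK. Qed.

Lemma subquot_map_cls z : subquot_map (cls z) = cls (submod_map z).
Proof.
apply/eqP; rewrite cls_eq -linearB.
rewrite -[val _]/(F (val (repr (cls z : subquot Z B) - z))) (F_ker (valP _)).
exact: repr_cls.
Qed.

Lemma subquot_map_linear : linear subquot_map.
Proof.
move=> k p q; have [x <-] := cls_surj p; have [y <-] := cls_surj q.
by rewrite -linearP !subquot_map_cls !linearP.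
Qed.

Lemma subquot_map_bijective :
  (forall w, w \in Z' -> exists2 x, x \in Z & w - F x \in B') ->
  bijective subquot_map.
Proof.
move=> F_surj; apply: inj_surj_bijective => [p q|q].
  have [x <-] := cls_surj p; have [y <-] := cls_surj q.
  rewrite !subquot_map_cls => /eqP; rewrite cls_eq -linearB.
  rewrite -[val _]/(F (val (x - y))) (F_ker (valP _)).
  by rewrite -cls_eq => /eqP.
have [w <-] := cls_surj q; have [x xZ wx] := F_surj _ (valP w).
exists (cls (Submod xZ)); rewrite subquot_map_cls; apply/eqP.
by rewrite eq_sym cls_eq.
Qed.

Lemma subquot_iso :
  (forall w, w \in Z' -> exists2 x, x \in Z & w - F x \in B') ->
  exists f : {linear subquot Z B -> subquot Z' B'}, bijective f.
Proof.
move=> F_surj; pose f : {linear subquot Z B -> subquot Z' B'} :=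
  HB.pack subquot_map (GRing.isLinear.Build K _ _ _ subquot_map subquot_map_linear).
by exists f; apply: subquot_map_bijective.
Qed.

End SubquotientMaps.

Section SubquotientToSubmodule.
Variables (K : pzRingType) (V W : lmodType K).
Variables (Z B : submodClosed V) (Z' : submodClosed W) (F : V -> W).
Hypothesis F_linear : forall k, {in Z &, forall x y, F (k *: x + y) = k *: F x + F y}.
Hypothesis F_in : forall x, x \in Z -> F x \in Z'.
Hypothesis F_ker : {in Z, forall x, (F x == 0) = (x \in B)}.

Definition subquot_submod (q : subquot Z B) : submod Z' :=
  submod_map F_in (repr q).

Lemma subquot_submod_cls z : val (subquot_submod (cls z)) = F (val z).
Proof.
have H := valP (repr (cls z : subquot Z B) - z).
have := repr_cls B z; rewrite -F_ker // => /eqP; rewrite [val _]linearB /=.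
by rewrite addrC -scaleN1r (F_linear _ (valP _) (valP _)) scaleN1r addrC => /subr0_eq.
Qed.

Lemma subquot_submod_linear : linear subquot_submod.
Proof.
move=> k p q; have [x <-] := cls_surj p; have [y <-] := cls_surj q.
apply: val_inj; rewrite -linearP subquot_submod_cls.
rewrite [RHS]linearP [in LHS]linearP (F_linear k (valP x) (valP y)).
by congr (k *: _ + _); apply/esym/subquot_submod_cls.
Qed.

Lemma subquot_submod_bijective :
  (forall w, w \in Z' -> exists2 x, x \in Z & F x = w) ->
  bijective subquot_submod.
Proof.
move=> F_surj; apply: inj_surj_bijective => [p q|w].
  have [x <-] := cls_surj p; have [y <-] := cls_surj q.
  move/(congr1 val); rewrite !subquot_submod_cls => Fxy; apply/eqP.
  rewrite cls_eq -(F_ker (valP _)) [val _]linearB /= addrC -scaleN1r.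
  by rewrite (F_linear _ (valP y) (valP x)) Fxy scaleN1r addNr.
have [x xZ wx] := F_surj _ (valP w).
by exists (cls (Submod xZ)); apply: val_inj; rewrite subquot_submod_cls.
Qed.

Lemma subquot_submod_iso :
  (forall w, w \in Z' -> exists2 x, x \in Z & F x = w) ->
  exists f : {linear subquot Z B -> submod Z'},
    bijective f /\ forall z, val (f (cls z)) = F (val z).
Proof.
move=> F_surj; pose f : {linear subquot Z B -> submod Z'} :=
  HB.pack subquot_submod
    (GRing.isLinear.Build K _ _ _ subquot_submod subquot_submod_linear).
exists f; split; first exact: subquot_submod_bijective.
exact: subquot_submod_cls.
Qed.

End SubquotientToSubmodule.

(* The cokernel of [T] on each [U] has the dimension of its kernel, so the two
   cokernels are isomorphic. *)
Lemma coker_transfer (K : fieldType) (V : vectType K) (T : 'End(V))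
    (U1 U2 : {vspace V}) : (T @: U1 <= U1)%VS -> (T @: U2 <= U2)%VS ->
  (U1 :&: lker T = U2 :&: lker T)%VS ->
  exists theta : 'End(V),
    [/\ forall x, theta x \in U2,
        forall x, x \in U1 -> (theta x \in (T @: U2)%VS) = (x \in (T @: U1)%VS)
      & forall w, w \in U2 -> exists2 x, x \in U1 & w - theta x \in (T @: U2)%VS].
Proof.
move=> T1 T2 kerE.
pose C1 := (U1 :\: T @: U1)%VS; pose C2 := (U2 :\: T @: U2)%VS.
have dC : \dim C1 = \dim C2.
  have dU U : (T @: U <= U)%VS -> \dim (U :\: T @: U) = \dim (U :&: lker T).
    move=> TU; apply/eqP; rewrite -(eqn_add2r (\dim (T @: U))) limg_ker_dim.
    by rewrite -dimv_disjoint_sum ?capv_diff // addv_diff (addv_idPl TU).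
  by rewrite !dU // kerE.
pose p1 := addv_pi1 U1 (T @: U1).
have p1C x : p1 x \in C1 by apply: memv_pi.
(* Project onto [C1] along [T @: U1], then match the bases of the two complements, which are equally
   long. *)
pose th v := \sum_(i < \dim C2)
  coord (vbasis C1) (cast_ord (esym dC) i) (p1 v) *: (vbasis C2)`_i.
have th_linear : linear th.
  move=> k u v; rewrite /th scaler_sumr -big_split; apply: eq_bigr => i _ /=.
  by rewrite !linearP scalerDl scalerA.
pose th' : {linear V -> V} := HB.pack th (GRing.isLinear.Build K _ _ _ th th_linear).
have thE v : linfun th' v = th v by rewrite lfunE.
have thC v : th v \in C2.
  apply: rpred_sum => i _; apply: rpredZ; apply: vbasis_mem; apply: mem_nth.
  by rewrite size_tuple.
have split U x : (T @: U <= U)%VS -> x \in U ->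
    addv_pi1 U (T @: U) x + addv_pi2 U (T @: U) x = x.
  by move=> TU xU; rewrite addv_pi1_pi2 // (addv_idPl TU).
exists (linfun th'); split=> [x|x xU|w wU]; rewrite ?thE.
- exact: (subvP (diffvSl _ _) _ (thC x)).
- apply/idP/idP => [thT|xT].
    have : th x \in (C2 :&: T @: U2)%VS by rewrite memv_cap thC.
    rewrite capv_diff memv0 => /eqP th0.
    have c0 := freeP (basis_free (vbasisP C2)) _ th0.
    suff p0 : p1 x = 0 by rewrite -(split _ _ T1 xU) -/p1 p0 add0r memv_pi2.
    rewrite (coord_vbasis (p1C x)) big1 // => j _.
    by have := c0 (cast_ord dC j); rewrite cast_ordK => ->; rewrite scale0r.
  have p0 : p1 x = 0.
    have := split _ _ T1 xU; rewrite addv_pi2_id // -/p1 => /(canRL (addrK _)).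
    by rewrite subrr.
  by rewrite /th big1 ?mem0v // => i _; rewrite p0 linear0 scale0r.
pose c := addv_pi1 U2 (T @: U2) w.
have cC : c \in C2 by apply: memv_pi.
pose x := \sum_(j < \dim C1) coord (vbasis C2) (cast_ord dC j) c *: (vbasis C1)`_j.
have xC : x \in C1.
  apply: rpred_sum => i _; apply: rpredZ; apply: vbasis_mem; apply: mem_nth.
  by rewrite size_tuple.
exists x; first exact: (subvP (diffvSl _ _) _ xC).
have -> : linfun th' x = c.
  rewrite thE /th /p1 /addv_pi1 daddv_pi_id ?capv_diff // [RHS](coord_vbasis cC).
  apply: eq_bigr => i _; rewrite coord_sum_free ?cast_ordKV //.
  exact: basis_free (vbasisP C1).
by rewrite -{1}(split _ _ T2 wU) addrC addKr memv_pi2.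
Qed.

(** * The Lie algebra of a simple Hom-Lie algebra *)

Lemma coordinates (K : fieldType) (g : vectType K) :
  exists n (v : {linear g -> 'rV[K]_n}) (r : {linear 'rV[K]_n -> g}),
    cancel v r /\ cancel r v.
Proof.
pose b := vbasis {:g}.
pose v x : 'rV[K]_(\dim {:g}) := \row_i coord b i x.
pose r (w : 'rV[K]_(\dim {:g})) : g := \sum_i w 0 i *: b`_i.
have vL : linear v by move=> k x y; apply/rowP => i; rewrite !mxE linearP.
have rL : linear r.
  move=> k x y; rewrite /r scaler_sumr -big_split; apply: eq_bigr => i _ /=.
  by rewrite !mxE scalerDl scalerA.
pose v' : {linear g -> 'rV[K]_(\dim {:g})} :=
  HB.pack v (GRing.isLinear.Build K _ _ _ v vL).
pose r' : {linear 'rV[K]_(\dim {:g}) -> g} :=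
  HB.pack r (GRing.isLinear.Build K _ _ _ r rL).
exists (\dim {:g}), v', r'; split=> [x|w] /=.
  rewrite [RHS](coord_vbasis (memvf x)); apply: eq_bigr => i _.
  by rewrite mxE.
by apply/rowP => i; rewrite mxE coord_sum_free ?(basis_free (vbasisP _)).
Qed.

Section YauTwist.
Variables (K : fieldType) (g : vectType K) (nu : {bilinear g -> g -> g}).
Variable beta : {linear g -> g}.

(** For [beta] the inverse of [alpha] this undoes the Yau twist of a Lie bracket. *)
Definition twisted_bracket (x y : g) : g := beta (nu x y).

Lemma twisted_bracket_bilinear :
  bilinear_for (GRing.Scale.Law.clone _ _ *:%R _) (GRing.Scale.Law.clone _ _ *:%R _)
    twisted_bracket.
Proof.
split=> [y|x] k u v; rewrite /twisted_bracket.
  by rewrite linearPl linearP.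
by rewrite linearPr linearP.
Qed.

HB.instance Definition _ :=
  bilinear_isBilinear.Build K g g g _ _ twisted_bracket twisted_bracket_bilinear.

End YauTwist.

Section Simple.
Variables (K : fieldType) (charK : [pchar K] =i pred0).
Variables (g : vectType K) (nu : {bilinear g -> g -> g}) (alpha : 'End(g)).
Hypotheses (g_hom_lie : hom_lie nu alpha) (g_simple : hom_lie_simple nu alpha).

Lemma bracketv_subP (I U : {vspace g}) :
  (forall x y, x \in I -> nu x y \in U) -> (bracketv nu I fullv <= U)%VS.
Proof.
move=> IU; apply/span_subvP => _ /allpairsP[[x y] /= [xI _ ->]].
by apply: IU; apply: vbasis_mem.
Qed.

Lemma lker_alpha0 : lker alpha == 0%VS.
Proof.
have [_ _ nuM] := g_hom_lie; have [a0 _ _ ideal] := g_simple.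
have [||->|kerT] := ideal (lker alpha) => //.
- apply/subvP => _ /memv_imgP[x xk ->]; move: xk; rewrite !memv_ker => /eqP ->.
  by rewrite linear0.
- apply: bracketv_subP => x y; rewrite !memv_ker nuM => /eqP ->.
  by rewrite linear0l.
case/negP: a0; apply/eqP/lfunP => x; rewrite lfunE /=; apply/eqP.
by rewrite -memv_ker kerT memvf.
Qed.

Local Notation beta := (alpha^-1)%VF.
Local Notation br := (twisted_bracket nu beta).

Lemma alphaK : cancel alpha beta.
Proof. exact: lker0_lfunK lker_alpha0. Qed.

Lemma betaK : cancel beta alpha.
Proof. exact: lker0_lfunVK lker_alpha0. Qed.

Lemma nuE x y : nu x y = alpha (br x y).
Proof. by rewrite betaK. Qed.

Lemma alpha_br x y : alpha (br x y) = br (alpha x) (alpha y).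
Proof. by have [_ _ nuM] := g_hom_lie; rewrite /twisted_bracket -nuM betaK; apply/esym/alphaK. Qed.

Lemma brxx x : br x x = 0.
Proof.
have [nuC _ _] := g_hom_lie; rewrite /twisted_bracket.
suff -> : nu x x = 0 by rewrite linear0.
(* Skew-symmetry only gives [2 nu x x = 0]; characteristic zero removes the 2. *)
apply/eqP; have /eqP := nuC x x; rewrite -addr_eq0 -mulr2n -scaler_nat scaler_eq0.
by move/pcharf0P: charK => ->.
Qed.

(** The Hom-Jacobi identity is [alpha] applied twice to the Jacobi identity of [br]. *)
Lemma brJ x y z : br x (br y z) = br (br x y) z + br y (br x z).
Proof.
have [nuC nuJ _] := g_hom_lie.
have brA a b : br a b = - br b a by rewrite /twisted_bracket nuC linearN.
have J : br (br x y) z + br (br y z) x + br (br z x) y = 0.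
  apply: (can_inj alphaK); apply: (can_inj alphaK); rewrite !linear0 -[RHS](nuJ x y z).
  by rewrite !linearD /= !alpha_br !nuE !alpha_br.
move/eqP: J; rewrite (brA (br y z)) (brA (br z x)) (brA z x).
by rewrite linearNr opprK addrAC subr_eq0 => /eqP <-.
Qed.

Lemma br_perfect (P : g -> Prop) : P 0 ->
  (forall k x y, P x -> P y -> P (k *: x + y)) ->
  (forall x y, P (br x y)) -> forall x, P x.
Proof.
move=> P0 PL Pbr x; have [_ perf _ _] := g_simple.
rewrite -(alphaK x); have : alpha x \in bracketv nu fullv fullv.
  by rewrite perf memvf.
move=> /(coord_span (X := in_tuple _)) ->; rewrite linear_sum.
elim/big_rec: _ => // i y _ Py; rewrite linearZ; apply: PL => //=.
have /allpairsP[[a b] /= [_ _ ->]] : (in_tuple [seq nu x y | x <- vbasis {:g}, y <- vbasis {:g}])`_i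
   \in [seq nu x y | x <- vbasis {:g}, y <- vbasis {:g}].
  by apply: mem_nth.
exact: Pbr.
Qed.

Lemma alpha_ideal (S : g -> Prop) : S 0 ->
  (forall k u v, S u -> S v -> S (k *: u + v)) ->
  (forall x, S x -> S (alpha x)) -> (forall x y, S x -> S (nu x y)) ->
  (forall x, S x -> x = 0) \/ (forall x, S x).
Proof.
move=> S0 SL Sa Sn; have [U US] := submod_vspace S0 SL.
have [_ _ _ ideal] := g_simple; have [||U0|UT] := ideal U.
- by apply/subvP => _ /memv_imgP[x /US xS ->]; apply/US/Sa.
- by apply: bracketv_subP => x y /US xS; apply/US/Sn.
- by left=> x /US; rewrite U0 memv0 => /eqP.
- by right=> x; apply/US; rewrite UT memvf.
Qed.

Lemma br_nonzero : ~ forall x y, br x y = 0.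
Proof.
move=> br0; have [_ perf gn0 _] := g_simple.
case/negP: gn0; rewrite -subv0 -perf; apply: bracketv_subP => x y _.
by rewrite nuE br0 linear0 mem0v.
Qed.

Variables (n : nat) (v : {linear g -> 'rV[K]_n}) (r : {linear 'rV[K]_n -> g}).
Hypotheses (vK : cancel v r) (rK : cancel r v).
Local Notation kf := (killing br v r).

Lemma killing_nondegenerate x : (forall y, kf x y = 0) -> x = 0.
Proof.
move: x.
have := @alpha_ideal (fun x => forall y, kf x y = 0).
case => [y|k u w u0 w0 y|x x0 y|x z x0 y|//|k0].
- by rewrite killing0l.
- by rewrite killingPl u0 w0 mulr0 addr0.
(* Invariance under automorphisms moves [alpha] to the other argument as its inverse. *)
- rewrite -[y]betaK (killing_aut vK rK _ _ alphaK betaK alpha_br); exact: x0.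
- rewrite nuE alpha_br (killing_inv brJ vK) -[X in killing _ _ _ _ X]betaK.
  by rewrite (killing_aut vK rK _ _ alphaK betaK alpha_br); apply: x0.
case: br_nonzero.
have adn := killing0_ad_nilpotent brJ vK rK charK br_perfect k0.
have gn0 : fullv != 0%VS :> {vspace g} by have [_ _] := g_simple.
have [m mn0 mC] := engel_center brxx brJ adn gn0.
case: (@alpha_ideal (fun m => forall h, br h m = 0)).
- by move=> h; rewrite linear0r.
- move=> k u w u0 w0 h.
  transitivity (k *: br h u + br h w); first exact: linearPr.
  by rewrite u0 w0 scaler0 addr0.
- by move=> t t0 h; rewrite -[h]betaK -alpha_br t0 linear0.
- move=> t z t0 h; have tz : br t z = 0.
    by rewrite [LHS](br_anti brxx) [X in - X]t0 oppr0.
  by rewrite nuE tz linear0; apply: linear0r.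
- by move/(_ m mC) => m0; rewrite m0 eqxx in mn0.
- by move=> C x y; apply: C.
Qed.

End Simple.

(** * The cohomology groups *)

Section Cohomology.
Variables (K : fieldType) (g : vectType K) (nu : {bilinear g -> g -> g}).
Variables (alpha beta : 'End(g)) (br : {bilinear g -> g -> g}).
Hypothesis alphaK : cancel alpha beta.
Hypothesis betaK : cancel beta alpha.
Hypothesis nuE : forall x y, nu x y = alpha (br x y).
Hypothesis alphaM : forall x y, alpha (br x y) = br (alpha x) (alpha y).
Hypothesis br_anti : forall x y, br x y = - br y x.
Hypothesis brJ : forall x y z, br x (br y z) = br (br x y) z + br y (br x z).
Variables (I : finType) (e e' : I -> g).
Hypothesis dual_invariant : forall (F : g -> g) x, linear F ->
  \sum_i (br (br (e i) x) (F (e' i)) + br (e i) (F (br (e' i) x))) = 0.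
Hypothesis casimir1 : forall x, \sum_i br (e i) (br (e' i) x) = x.

Local Notation tau := (twist alpha beta).
Local Notation tau' := (twist beta alpha).
Local Notation s := (homotopy br e e').
Local Notation betaM := (betaM alphaK betaK alphaM).

Lemma homotopy0 n : homotopy br e e' (0 : ('I_n -> g) -> g) = 0.
Proof. by apply/funext => z; rewrite /homotopy big1 // => i _; apply: linear0r. Qed.

Lemma ce_homotopy n (f : ('I_n.+1 -> g) -> g) : alternating f ->
  @ce _ _ br n.+2 f = 0 -> ce br (s f) = f.
Proof.
move=> fA f0; rewrite -[RHS](homotopy_ce brJ dual_invariant casimir1 fA) f0.
by rewrite homotopy0 addr0.
Qed.

Lemma ceB n (f f' : ('I_n.-1 -> g) -> g) : ce br (f - f') = ce br f - ce br f'.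
Proof. by rewrite linearB. Qed.

Lemma ceD n (f f' : ('I_n.-1 -> g) -> g) : ce br (f + f') = ce br f + ce br f'.
Proof. by rewrite linearD. Qed.

Lemma tau_ce n (f : ('I_n.-1 -> g) -> g) : tau (ce br f) = ce br (tau f).
Proof. exact: (@twist_ce K g br alpha beta alphaM betaM alphaK n f). Qed.

Lemma tau'_ce n (f : ('I_n.-1 -> g) -> g) : tau' (ce br f) = ce br (tau' f).
Proof. exact: (@twist_ce K g br beta alpha betaM alphaM betaK n f). Qed.

Lemma tauK n : cancel (@twist _ g alpha beta n) (@twist _ g beta alpha n).
Proof. exact: twistK. Qed.

Lemma tau'K n : cancel (@twist _ g beta alpha n) (@twist _ g alpha beta n).
Proof. exact: twistK. Qed.

Lemma tauB n (f f' : ('I_n -> g) -> g) : tau (f - f') = tau f - tau f'.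
Proof. by apply/funext => x; apply: (linearB beta). Qed.

Lemma tauD n (f f' : ('I_n -> g) -> g) : tau (f + f') = tau f + tau f'.
Proof. by apply/funext => x; apply: (linearD beta). Qed.

Lemma tau0 n : tau (0 : ('I_n -> g) -> g) = 0.
Proof. by apply/funext => x; apply: (linear0 beta). Qed.

Lemma tau'B n (f f' : ('I_n -> g) -> g) : tau' (f - f') = tau' f - tau' f'.
Proof. by apply/funext => x; apply: (linearB alpha). Qed.

Lemma alternatingB n (f f' : ('I_n -> g) -> g) :
  alternating f -> alternating f' -> alternating (f - f').
Proof.
move=> fA f'A; have := alternatingP (-1) f'A fA.
by rewrite scaleN1r addrC.
Qed.

(** [G] is a primitive of [f]; the second cocycle equation makes [u] closed, with primitive [E].
    From degree 3 on, [E] has positive degree, hence is an admissible cochain. *)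
Lemma cocycle_coboundary n (c : precochain g n.+3) :
  c \in cocycles nu alpha n.+3 -> c \in coboundaries nu alpha n.+3.
Proof.
move=> /andP[cC /eqP c0].
have [f0 fh] := (cocycle_cone alphaK betaK nuE alphaM brJ cC).1 c0.
have fA := cone_fst_alternating beta br cC; have hA := cone_snd_Alt beta cC.
set f := cone_fst _ _ _ in f0 fh fA; set h := cone_snd _ _ in fh hA.
have hA' : alternating h by apply: Alt_alternating.
pose G := s f; have GA : @alternating _ g n.+2 G := alternating_homotopy br e e' fA.
have ceG : ce br G = f by apply: ce_homotopy.
pose u := G - tau G - tau h.
have uA : @alternating _ g n.+2 u.
  by do !apply: alternatingB => //; apply: alternating_twist.
have ceu : @ce _ _ br n.+3 u = 0.
  by rewrite /u !ceB -!(@tau_ce n.+3) ceG fh subrr.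
pose E := s u; have ceE : ce br E = u by apply: ce_homotopy.
have EA : @alternating _ g n.+1 E := alternating_homotopy br e e' uA.
(* The inverse twists on [G] and [E] compensate the factors [tau] in the cone coboundary. *)
apply/asboolP; exists (@cone_cochain _ _ alpha br n.+2 (tau' G) (tau' (tau' E))).
  apply: cone_cochain_in; first exact: alternating_twist.
  by apply/AltP; do 2!apply: alternating_twist.
rewrite (coboundary_cone alphaK betaK nuE alphaM brJ); last first.
  by apply/AltP; do 2!apply: alternating_twist.
rewrite -tau'_ce ceG tau'K -!tau'_ce ceE !tau'K.
rewrite -[LHS](cone_cochain_coord br betaK) -/f -/h; congr cone_cochain.
by rewrite /u !tau'B !tauK subKr.
Qed.

(** * Degree one: endomorphisms and derivations *)

Definition of1 (phi : 'End(g)) : ('I_1 -> g) -> g := fun x => phi (x ord0).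

Definition to1 (f : ('I_1 -> g) -> g) : 'End(g) := linfun (fun x => f (fun=> x)).

Lemma ord1_fun (x : 'I_1 -> g) : (fun=> x ord0) = x.
Proof. by apply/funext => i; rewrite (ord1 i). Qed.

Lemma to1E f x : alternating f -> to1 f x = f (fun=> x).
Proof.
move=> fA; pose y : 'I_0 -> g := fun=> 0.
have fL : linear (fun x => f (fun=> x)).
  have E a : (fun=> a) = @consf K g 1 a y.
    by rewrite -[LHS]consf_eta; congr consf; apply/funext => -[].
  by move=> k a b; rewrite !E; apply: (alternating_linear y fA).
pose f' : {linear g -> g} := HB.pack (fun x => f (fun=> x))
  (GRing.isLinear.Build K _ _ _ _ fL).
by rewrite /to1 -[fun x => _]/(f' : g -> g) lfunE.
Qed.

Lemma alternating_of1 phi : alternating (of1 phi).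
Proof.
split=> // y k a b; rewrite /of1 !consf_ord0; exact: linearP.
Qed.

Lemma to1K f : alternating f -> of1 (to1 f) = f.
Proof. by move=> fA; apply/funext => x; rewrite /of1 to1E // ord1_fun. Qed.

Lemma of1K phi : to1 (of1 phi) = phi.
Proof. by apply/lfunP => x; rewrite to1E //; apply: alternating_of1. Qed.

Lemma to1P k (f f' : ('I_1 -> g) -> g) : alternating f -> alternating f' ->
  to1 (k *: f + f') = k *: to1 f + to1 f'.
Proof.
move=> fA f'A; apply/lfunP => x; rewrite to1E; last exact: alternatingP.
by rewrite !lfunE /= lfunE /= !to1E.
Qed.

Lemma of1P k phi psi : of1 (k *: phi + psi) = k *: of1 phi + of1 psi.
Proof. by apply/funext => x; rewrite /of1 !lfunE /= lfunE. Qed.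

Lemma of1B phi psi : of1 (phi - psi) = of1 phi - of1 psi.
Proof. by apply/funext => x; rewrite /of1 !lfunE /= lfunE. Qed.

Lemma tau_of1 phi : tau (of1 phi) = of1 (beta \o phi \o alpha)%VF.
Proof. by apply/funext => x; rewrite /of1 /twist !lfunE /= lfunE. Qed.

Lemma ce_of1 phi a b (z : 'I_0 -> g) :
  @ce _ _ br 2 (of1 phi) (@consf K g 2 a (@consf K g 1 b z)) =
  br a (phi b) + br (phi a) b - phi (br a b).
Proof.
rewrite /ce subfctE ce1_consf ce2_consf; last exact: alternating_of1.
rewrite ce1_consf /ce1 ssum0 subr0 /cobr ssum_consf ssum0 subr0.
rewrite /ce2 psum1 subr0 /contract /of1 !consf_ord0.
by rewrite [in RHS](br_anti (phi a)).
Qed.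

Lemma ce_of1_eq0 phi : @ce _ _ br 2 (of1 phi) = 0 <->
  forall a b, phi (br a b) = br (phi a) b + br a (phi b).
Proof.
split=> [H a b|H].
  have := ce_of1 phi a b (fun=> 0); rewrite H => /esym/eqP.
  by rewrite subr_eq0 addrC => /eqP.
apply/funext; elim/consf_ind => a; elim/consf_ind => b z.
by rewrite ce_of1 H [X in X - _]addrC subrr.
Qed.

Lemma ce_degree0 (h : ('I_0 -> g) -> g) : h = 0 -> @ce _ _ br 1 h = 0.
Proof. by move=> ->; rewrite linear0. Qed.

Lemma commute_of1 phi : tau (of1 phi) = of1 phi <->
  (alpha \o phi = phi \o alpha)%VF.
Proof.
rewrite tau_of1; split=> [/(congr1 to1)|H].
  rewrite !of1K => {1}<-; apply/lfunP => x; do !rewrite lfunE /=; rewrite betaK.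
  by [].
congr of1; apply/lfunP => x; have /lfunP/(_ x) := H.
by rewrite !lfunE /= lfunE /= => <-; rewrite alphaK.
Qed.

(** When [phi] commutes with [alpha], the derivation identity for [nu] is [alpha] applied to the one
    for [br]. *)
Lemma Der_commute phi : tau (of1 phi) = of1 phi ->
  (@ce _ _ br 2 (of1 phi) = 0 <-> phi \in Der nu).
Proof.
move=> /commute_of1/lfunP pa; have {}pa x : alpha (phi x) = phi (alpha x).
  by have := pa x; rewrite !lfunE.
rewrite ce_of1_eq0; split=> [H|/asboolP H].
  by apply/asboolP => x y; rewrite !nuE -pa H linearD.
move=> a b; apply: (can_inj alphaK).
by rewrite pa -nuE H !nuE linearD.
Qed.

Lemma cocycles1P (c : precochain g 1) : c \in cocycles nu alpha 1 <->
  [/\ alternating c.1, c.2 = 0 & to1 c.1 \in Der_alpha nu alpha].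
Proof.
have snd0 : c.2 = 0 -> cone_snd beta c = 0.
  by move=> c2; apply/funext => x; rewrite /cone_snd c2.
have fst1 : c.2 = 0 -> cone_fst beta br c = c.1.
  by move=> c2; rewrite /cone_fst snd0 // linear0; apply/funext => x; apply: subr0.
have DerP phi : phi \in Der_alpha nu alpha <->
    @ce _ _ br 2 (of1 phi) = 0 /\ tau (of1 phi) = of1 phi.
  split=> [/andP[pD /eqP /commute_of1 pa]|[p0 pa]].
    by split=> //; apply/Der_commute.
  apply/andP; split; first exact/(Der_commute pa).
  exact/eqP/commute_of1.
split=> [/andP[cC /eqP c0]|[fA c2 /DerP[f0 fa]]].
  have [f0 fh] := (cocycle_cone alphaK betaK nuE alphaM brJ cC).1 c0.
  have /andP[/AltP fA /Alt0P c2] := cC.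
  rewrite fst1 // snd0 // ce_degree0 // in f0 fh.
  split=> //; apply/DerP; rewrite to1K //; split=> //.
  by move: fh; rewrite tau0 => /eqP; rewrite subr_eq0 => /eqP <-.
have cC : c \in cochains g 1 by apply/andP; split; [apply/AltP | apply/Alt0P].
apply/andP; split=> //; apply/eqP.
apply/(cocycle_cone alphaK betaK nuE alphaM brJ cC).
rewrite fst1 // snd0 // ce_degree0 //; rewrite to1K // in f0 fa.
rewrite fa subrr; split=> //.
by apply/funext => x; symmetry; apply: (linear0 beta).
Qed.

Lemma coboundaries1 (c : precochain g 1) : c \in coboundaries nu alpha 1 <-> c = 0.
Proof.
split=> [/asboolP[[b1 b2] /andP[/Alt0P /= -> /Alt0P /= ->] ->]|->].
  exact: (linear0 (@coboundary K g nu alpha 0)).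
exact: rpred0.
Qed.

Lemma cohomology1_iso : exists f : {linear cohomology nu alpha 1%N -> submod (Der_alpha nu alpha)},
  bijective f /\
  forall (z : submod (cocycles nu alpha 1%N)) (x : g),
    val (f (cls z)) x = (val z).1 (fun=> x).
Proof.
pose F (c : precochain g 1) := to1 c.1.
have F_linear k : {in cocycles nu alpha 1 &,
    forall x y, F (k *: x + y) = k *: F x + F y}.
  by move=> x y /cocycles1P[xA _ _] /cocycles1P[yA _ _]; apply: to1P.
have F_in x : x \in cocycles nu alpha 1 -> F x \in Der_alpha nu alpha.
  by move=> /cocycles1P[].
have F_ker : {in cocycles nu alpha 1,
    forall x, (F x == 0) = (x \in coboundaries nu alpha 1)}.
  move=> [f h] /cocycles1P[/= fA h0 _]; apply/eqP/idP => [F0|/coboundaries1[-> _]].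
    apply/coboundaries1; congr pair => //.
    by rewrite -(to1K fA) -/(F (f, h)) F0; apply/funext => x; rewrite /of1 lfunE.
  apply/lfunP => x; rewrite to1E; last exact: alternating0.
  by [].
have [phi phiD|f [f_bij fE]] := subquot_submod_iso F_linear F_in F_ker.
  exists (of1 phi, 0); last exact: of1K.
  by apply/cocycles1P; split; rewrite ?of1K //; apply: alternating_of1.
exists f; split=> // z x; rewrite fE /F to1E //.
by have /cocycles1P[] := valP z.
Qed.

(** * Degree two: the cokernel of [1 - tau] on derivations *)

Definition conj_defect (phi : 'End(g)) : 'End(g) :=
  phi - (beta \o phi \o alpha)%VF.

Lemma conj_defect_linear : linear conj_defect.
Proof.
move=> k phi psi; apply/lfunP => x; rewrite /conj_defect.
by do !rewrite lfunE /=; rewrite linearP scalerBr !opprD addrACA.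
Qed.

HB.instance Definition _ :=
  GRing.isLinear.Build K _ _ _ conj_defect conj_defect_linear.

Lemma of1_conj_defect phi : of1 (conj_defect phi) = of1 phi - tau (of1 phi).
Proof. by rewrite of1B tau_of1. Qed.

Lemma conj_defect_eq0 phi : conj_defect phi = 0 <-> tau (of1 phi) = of1 phi.
Proof.
rewrite tau_of1 /conj_defect; split=> [/subr0_eq <- //|].
by move=> /(congr1 to1); rewrite !of1K => ->; rewrite subrr.
Qed.

Lemma d_alphaE phi : d_alpha alpha phi = (alpha \o conj_defect phi)%VF.
Proof.
apply/lfunP => x; rewrite /d_alpha /conj_defect; do !rewrite lfunE /=.
by rewrite linearB /= betaK.
Qed.

Lemma Der_conj_defect phi : phi \in Der nu -> conj_defect phi \in Der nu.
Proof.
move=> phiD; rewrite /conj_defect rpredB //; move/asboolP: phiD => phiD.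
have anu x y : alpha (nu x y) = nu (alpha x) (alpha y) by rewrite !nuE alphaM.
have bnu x y : beta (nu x y) = nu (beta x) (beta y).
  by apply: (can_inj alphaK); rewrite anu !betaK.
apply/asboolP => x y; do !rewrite lfunE /=.
by rewrite anu phiD linearD /= !bnu !alphaK.
Qed.

Lemma d_alpha_Der_sub : {subset d_alpha_Der nu alpha <= alpha_Der nu alpha}.
Proof.
move=> _ /asboolP[phi phiD ->]; apply/asboolP; exists (conj_defect phi).
  exact: Der_conj_defect.
exact: d_alphaE.
Qed.

(* [class2 c] is the derivation of [br] which represents the class of the
   2-cocycle [c] in the cokernel of [conj_defect]. *)
Definition class2_fun (c : precochain g 2) : ('I_1 -> g) -> g :=
  cone_snd beta c - (tau' (s (cone_fst beta br c)) - s (cone_fst beta br c)).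

Definition class2 (c : precochain g 2) : 'End(g) := to1 (class2_fun c).

Lemma class2_fun_linear k c c' :
  class2_fun (k *: c + c') = k *: class2_fun c + class2_fun c'.
Proof.
rewrite /class2_fun cone_snd_linear cone_fst_linear homotopyP.
have -> f f' : tau' (k *: f + f') = k *: tau' f + tau' f' :> (('I_1 -> g) -> g).
  by apply/funext => x; apply: (linearP alpha).
by rewrite !scalerBr !opprD !opprK; rewrite [RHS]addrACA; congr (_ + _); rewrite [RHS]addrACA.
Qed.

Lemma class2_fun_alternating c : c \in cochains g 2 -> alternating (class2_fun c).
Proof.
move=> cC; have fA := cone_fst_alternating beta br cC.
have hA := Alt_alternating (cone_snd_Alt beta cC).
have GA := alternating_homotopy br e e' fA.
apply: alternatingB => //; apply: alternatingB => //.
exact: alternating_twist.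
Qed.

(** Undoing [tau] in the second cocycle equation gives [tau' f - f = ce h]; as [ce (s f) = f], the
    correction in [class2_fun] makes it closed. *)
Lemma cocycle2_facts c : c \in cocycles nu alpha 2 ->
  [/\ alternating (class2_fun c), ce br (s (cone_fst beta br c)) = cone_fst beta br c
    & @ce _ _ br 2 (class2_fun c) = 0].
Proof.
move=> /andP[cC /eqP c0]; split; first exact: class2_fun_alternating.
  apply: ce_homotopy; first exact: cone_fst_alternating.
  exact: ((cocycle_cone alphaK betaK nuE alphaM brJ cC).1 c0).1.
have [f0 fh] := (cocycle_cone alphaK betaK nuE alphaM brJ cC).1 c0.
have ceG : ce br (s (cone_fst beta br c)) = cone_fst beta br c.
  by apply: ce_homotopy => //; apply: cone_fst_alternating.
rewrite /class2_fun !ceB -tau'_ce ceG.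
have := congr1 (@twist _ g beta alpha 2) fh; rewrite tauK tau'B tauK => <-.
by rewrite subrr.
Qed.

Lemma cone_cochain_cocycle n (f : ('I_n.+1 -> g) -> g) (h : ('I_n -> g) -> g) :
  alternating f -> h \in @Alt K g n ->
  @ce _ _ br n.+2 f = 0 -> f - tau f = tau (@ce _ _ br n.+1 h) ->
  @cone_cochain _ _ alpha br n.+1 f h \in cocycles nu alpha n.+1.
Proof.
move=> fA hA f0 fh; have cC := cone_cochain_in alpha br fA hA.
apply/andP; split=> //; apply/eqP.
apply/(cocycle_cone alphaK betaK nuE alphaM brJ cC).
by rewrite (cone_fstE br alphaK) (cone_sndE br alphaK).
Qed.

(** A coboundary has coordinates [(tau (ce l), l - tau l)], and [delta] corresponds to
    [l - tau' (s f)], which is closed exactly when [f = tau (ce l)]. *)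
Lemma class2_coboundary c : c \in cocycles nu alpha 2 ->
  c \in coboundaries nu alpha 2 <->
  exists2 delta, @ce _ _ br 2 (of1 delta) = 0 & class2 c = conj_defect delta.
Proof.
move=> cZ; have [wA ceG w0] := cocycle2_facts cZ.
have GA : alternating (s (cone_fst beta br c)).
  have /andP[cC _] := cZ.
  exact: (alternating_homotopy br e e' (cone_fst_alternating beta br cC)).
have ce00 : @ce _ _ br 1 0 = 0 by apply: ce_degree0.
split=> [/asboolP[b bC cE]|[delta d0 cE]].
  have bh := cone_snd_Alt beta bC; have lA := cone_fst_alternating beta br bC.
  have [fE hE] : cone_fst beta br c = tau (@ce _ _ br 2 (cone_fst beta br b)) /\
      cone_snd beta c = cone_fst beta br b - tau (cone_fst beta br b).
    rewrite cE -{1 3}(cone_cochain_coord br betaK b).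
    rewrite (coboundary_cone alphaK betaK nuE alphaM brJ) //.
    rewrite (cone_fstE br alphaK) (cone_sndE br alphaK).
    by have /Alt0P -> := bh; rewrite ce00 tau0 subr0.
  set l := cone_fst _ _ b in lA fE hE.
  pose dlt := l - tau' (s (cone_fst beta br c)).
  have dA : alternating dlt by apply: alternatingB => //; apply: alternating_twist.
  exists (to1 dlt).
    rewrite to1K // /dlt ceB -tau'_ce ceG fE tauK subrr.
    by [].
  rewrite -[conj_defect _]of1K of1_conj_defect to1K // /class2; congr to1.
  rewrite /class2_fun hE /dlt (tauB l) tau'K !opprB.
  by rewrite [LHS](AC (2*2) ((1*4)*(3*2))).
pose d := of1 delta; pose l := tau' (s (cone_fst beta br c)) + d.
have lA : alternating l.
  have := alternatingP 1 (alternating_twist beta alpha GA) (alternating_of1 delta).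
  by rewrite scale1r.
apply/asboolP; exists (@cone_cochain _ _ alpha br 1 l 0).
  by apply: cone_cochain_in => //; apply/Alt0P.
rewrite (coboundary_cone alphaK betaK nuE alphaM brJ); last exact/Alt0P.
rewrite ce00 tau0 subr0 -[LHS](cone_cochain_coord br betaK); congr cone_cochain.
  by rewrite /l ceD [X in _ + X]d0 addr0 -tau'_ce ceG tau'K.
have wE : class2_fun c = d - tau d.
  by rewrite -(to1K wA) -/(class2 c) cE of1_conj_defect.
have -> : cone_snd beta c = class2_fun c +
    (tau' (s (cone_fst beta br c)) - s (cone_fst beta br c)) by rewrite subrK.
rewrite wE /l (tauD (tau' _)) tau'K opprD.
by rewrite [LHS](AC (2*2) ((3*1)*(4*2))).
Qed.

(** [class2] leads to [D / T D], with [D] the derivations of [br] and [T] equal to [1 - tau];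
    [coker_transfer] passes to [E / T E], with [E] the derivations of [nu]; composing with [alpha]
    ends in the required quotient by [d_alphaE]. *)
Lemma cohomology2_iso : exists f : {linear cohomology nu alpha 2%N ->
    subquot (alpha_Der nu alpha) (d_alpha_Der nu alpha)}, bijective f.
Proof.
pose T : 'End('End(g)) := linfun conj_defect.
have TE phi : T phi = conj_defect phi by rewrite lfunE.
have [D memD] : exists D : {vspace 'End(g)},
    forall phi, phi \in D <-> @ce _ _ br 2 (of1 phi) = 0.
  apply: submod_vspace => [|k phi psi phi0 psi0].
    have -> : of1 0 = 0 by apply/funext => x; rewrite /of1 lfunE.
    by rewrite linear0.
  by rewrite of1P linearP /= phi0 psi0 scaler0 addr0.
have [E memE] : exists E : {vspace 'End(g)}, forall phi, phi \in E <-> phi \in Der nu.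
  apply: submod_vspace => [|k phi psi phiD psiD]; first exact: rpred0.
  by rewrite rpredD // rpredZ.
have TD : (T @: D <= D)%VS.
  apply/subvP => _ /memv_imgP[phi /memD phi0 ->]; apply/memD.
  rewrite TE of1_conj_defect ceB -tau_ce phi0 sub0r.
  by rewrite tau0 oppr0.
have TEs : (T @: E <= E)%VS.
  apply/subvP => _ /memv_imgP[phi /memE phiD ->]; apply/memE.
  by rewrite TE; apply: Der_conj_defect.
(* The kernel of [T] consists of the maps commuting with [alpha], to which [Der_commute] applies. *)
have kerE : (D :&: lker T = E :&: lker T)%VS.
  apply/vspaceP => phi; rewrite !memv_cap !memv_ker TE.
  have [/conj_defect_eq0 phia|] := eqVneq (conj_defect phi) 0; last by rewrite !andbF.
  rewrite !andbT; apply/idP/idP.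
    by move=> /memD /(Der_commute phia) /memE.
  by move=> /memE /(Der_commute phia) /memD.
have [theta [thE thT thS]] := coker_transfer TD TEs kerE.
pose F c := (alpha \o theta (class2 c))%VF.
have class2D c : c \in cocycles nu alpha 2 -> class2 c \in D.
  by move=> /cocycle2_facts[wA _ w0]; apply/memD; rewrite to1K.
apply: (subquot_iso (F := F)).
- move=> k c c' cZ c'Z; have [wA _ _] := cocycle2_facts cZ.
  have [w'A _ _] := cocycle2_facts c'Z.
  rewrite /F /class2 class2_fun_linear to1P // linearP.
  by rewrite comp_lfunDr -comp_lfunZr.
- move=> c cZ; apply/asboolP; exists (theta (class2 c)) => //.
  exact/memE/thE.
- move=> c cZ; apply/idP/idP.
    move=> /asboolP[psi psiD]; rewrite d_alphaE => /lfunP Fpsi.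
    have thpsi : theta (class2 c) = T psi.
      apply/lfunP => x; apply: (can_inj alphaK).
      by move: (Fpsi x); rewrite TE /F lfunE [RHS]lfunE.
    have : theta (class2 c) \in (T @: E)%VS.
      by rewrite thpsi memv_img //; apply/memE.
    rewrite thT ?class2D // => /memv_imgP[delta /memD d0 cE].
    by apply/(class2_coboundary cZ); exists delta; rewrite -?TE.
  move=> /(class2_coboundary cZ)[delta d0 cE].
  have : theta (class2 c) \in (T @: E)%VS.
    by rewrite thT ?class2D // cE -TE memv_img //; apply/memD.
  case/memv_imgP=> psi /memE psiD thpsi; apply/asboolP; exists psi => //.
  by rewrite d_alphaE -TE -thpsi.
move=> _ /asboolP[psi psiD ->].
have [phi phiD /memv_imgP[chi chiE wE]] := thS psi ((memE psi).2 psiD).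
have phi0 := (memD phi).1 phiD.
(* With first coordinate 0 the correction in [class2_fun] vanishes, so the class is [phi] itself. *)
exists (@cone_cochain _ _ alpha br 2 0 (of1 phi)).
  apply: cone_cochain_cocycle => //.
  - exact: alternating0.
  - exact/AltP/alternating_of1.
  - by rewrite linear0.
  - by rewrite phi0 tau0 subrr.
rewrite /F (_ : class2 _ = phi); last first.
  rewrite /class2 /class2_fun (cone_fstE br alphaK) (cone_sndE br alphaK) homotopy0.
  rewrite (_ : tau' 0 = 0) ?subr0 ?of1K //.
  by apply/funext => x; apply: (linear0 alpha).
apply/asboolP; exists chi; first exact/memE.
by rewrite d_alphaE -TE -wE comp_lfunDr comp_lfunNr.
Qed.

End Cohomology.

Theorem theorem2p9 (K : fieldType) (charK : [pchar K] =i pred0)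
  (g : vectType K) (nu : {bilinear g -> g -> g}) (alpha : 'End(g))
  (g_hom_lie : hom_lie nu alpha) (g_simple : hom_lie_simple nu alpha) :
  [/\ exists f : {linear cohomology nu alpha 1%N -> submod (Der_alpha nu alpha)},
        bijective f /\
        forall (z : submod (cocycles nu alpha 1%N)) (x : g),
          val (f (cls z)) x = (val z).1 (fun=> x),
      {subset d_alpha_Der nu alpha <= alpha_Der nu alpha} /\
      (exists f : {linear cohomology nu alpha 2%N ->
                     subquot (alpha_Der nu alpha) (d_alpha_Der nu alpha)},
        bijective f)
    & forall k : nat, (3 <= k)%N ->
        forall h : cohomology nu alpha k, h = 0].
Proof.
have [n [v [r [vK rK]]]] := coordinates g.
have aK := alphaK g_hom_lie g_simple; have bK := betaK g_hom_lie g_simple.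
have nE := nuE g_hom_lie g_simple; have aM := alpha_br g_hom_lie g_simple.
have bxx := brxx charK g_hom_lie.
have bJ := brJ g_hom_lie g_simple.
have nd := killing_nondegenerate charK g_hom_lie g_simple vK rK.
have dual := dual_invariant bxx bJ vK rK nd.
have cas := casimir1 bxx bJ vK rK nd.
have bA := br_anti bxx.
split.
- exact: (cohomology1_iso aK bK nE aM bA bJ).
- split; first exact: (d_alpha_Der_sub aK bK nE aM).
  exact: (cohomology2_iso aK bK nE aM bA bJ dual cas).
case=> [|[|[|k]]] // _ h; have [x <-] := cls_surj h.
rewrite -(linear0 (@cls _ _ _ _)); apply/eqP; rewrite cls_eq subr0.
exact: (cocycle_coboundary aK bK nE aM bJ dual cas (valP x)).
Qed.
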